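(* Let $K$ be a field, $d\ge1$, and $R=K[[x_1,\dots,x_d]]/(x_1\cdots x_d)$. Then: (i) if $d=1$, then $R$ is Lech-stable; (ii) if $d=2$, then $R$ is semistable but not stable; (iii) if $d\ge3$, then $R$ is stable but not Lech-stable.
   Context: All rings are commutative, Noetherian, with $1$. For a local ring $(R,\mathfrak m)$ of dimension $n$ and an $\mathfrak m$-primary ideal $I$, $\ell$ denotes length and $e(I)=\lim_{m\to\infty} n!\,\ell(R/I^m)/m^n$ is the Hilbert--Samuel multiplicity. The Lech--Mumford constant is $c_{LM}(R)=\sup_{\sqrt I=\mathfrak m}\frac{e(I)}{n!\,\ell(R/I)}$. $R$ is Lech-stable if $c_{LM}(R)=1$; semistable if $c_{LM}(R[[T]])=1$; stable if it is semistable and the supremum defining $c_{LM}(R[[T]])$ is not attained. *)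

(* Defs.v *)
From HB Require Import structures.
From mathcomp Require Import all_boot all_order all_algebra.
(* mpoly has to be imported before the analysis files: its notations cannot be
   declared after theirs. *)
From mathcomp Require Import mpoly zify.
From mathcomp Require Import boolp classical_sets functions reals.
From mathcomp Require Import constructive_ereal ereal topology normedtype.

Set Implicit Arguments.
Unset Strict Implicit.
Unset Printing Implicit Defensive.

Import Order.TTheory GRing.Theory Num.Theory.
Import numFieldNormedType.Exports.

Local Open Scope classical_set_scope.
Local Open Scope ring_scope.
Local Open Scope quotient_scope.

Section Ideals.
Variable R : comPzRingType.
Implicit Types (I J : set R) (P : set (set R)).

Definition ideal I : Prop :=
  [/\ I 0, forall x y, I x -> I y -> I (x + y) & forall a x, I x -> I (a * x)].

Definition prime_ideal I : Prop :=
  [/\ ideal I, ~ I 1 & forall x y, I (x * y) -> I x \/ I y].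

Definition ideal_mul I J : set R :=
  smallest ideal [set z | exists x y, [/\ I x, J y & z = x * y]].

Definition ideal_exp I (m : nat) : set R := iter m (ideal_mul I) setT.

Definition radical I : set R := [set x | exists m : nat, I (x ^+ m)].

(* The maximal ideal, when R is local. *)
Definition nonunits : set R := [set x | ~ exists y, x * y = 1].

Definition primary_to_max I : Prop := ideal I /\ radical I = nonunits.

(* The strict chains c 0 < ... < c k of members of P have length k. The value
   is 0 if P is empty or has chains of unbounded length. *)
Definition strict_chain P (k : nat) (c : nat -> set R) : Prop :=
  (forall i, (i <= k)%N -> P (c i)) /\
  (forall i, (i < k)%N -> c i `<` c i.+1).

Definition max_chain_length P : nat :=
  supremum 0%N [set k | exists c, strict_chain P k c].

Definition krull_dim : nat := max_chain_length prime_ideal.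

(* The length of the R-module R / I, whose submodules are the J / I for J an
   ideal containing I. *)
Definition quo_length I : nat :=
  max_chain_length [set J | ideal J /\ I `<=` J].

End Ideals.

Arguments nonunits : clear implicits.
Arguments krull_dim : clear implicits.

Section LechMumford.
Variables (F : realType) (R : comPzRingType).

Definition multiplicity (I : set R) : F :=
  let n := krull_dim R in
  lim ((fun m : nat => n`!%:R * (quo_length (ideal_exp I m))%:R / m%:R ^+ n : F)
         @ \oo).

Definition lech_ratio (I : set R) : F :=
  multiplicity I / ((krull_dim R)`!%:R * (quo_length I)%:R).

Definition lech_mumford : \bar F :=
  ereal_sup [set (lech_ratio I)%:E | I in @primary_to_max R].

Definition lech_stable : Prop := lech_mumford = 1%:E.

End LechMumford.

Section PowerSeries.
Variables (n : nat) (A : comPzRingType).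

Record fps := Fps { fps_coef : 'X_{1..n} -> A }.

HB.instance Definition _ := [isNew for fps_coef].
HB.instance Definition _ := [Choice of fps by <:].

Implicit Types f g h : fps.

Lemma fpsP f g : fps_coef f =1 fps_coef g -> f = g.
Proof. by case: f g => [f] [g] /= /funext ->. Qed.

Definition fps_zero := Fps (fun=> 0).
Definition fps_opp f := Fps (fun m => - fps_coef f m).
Definition fps_add f g := Fps (fun m => fps_coef f m + fps_coef g m).
Definition fps_one := Fps (fun m => (m == 0%MM)%:R).
Definition fps_mul f g := Fps (fun m =>
  \sum_(k : 'X_{1..n < (mdeg m).+1} | (k <= m)%MM)
     fps_coef f k * fps_coef g (m - k)%MM).

Lemma fps_addA : associative fps_add.
Proof. by move=> f g h; apply: fpsP => m /=; rewrite addrA. Qed.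
Lemma fps_addC : commutative fps_add.
Proof. by move=> f g; apply: fpsP => m /=; rewrite addrC. Qed.
Lemma fps_add0 : left_id fps_zero fps_add.
Proof. by move=> f; apply: fpsP => m /=; rewrite add0r. Qed.
Lemma fps_addN : left_inverse fps_zero fps_opp fps_add.
Proof. by move=> f; apply: fpsP => m /=; rewrite addNr. Qed.

HB.instance Definition _ :=
  GRing.isZmodule.Build fps fps_addA fps_addC fps_add0 fps_addN.

Lemma lem_mdeg (k m : 'X_{1..n}) : (k <= m)%MM -> (mdeg k <= mdeg m)%N.
Proof. by move=> km; rewrite -(submK km) mdegD leq_addl. Qed.

Lemma fps_coef_mul b f g m : (mdeg m < b)%N ->
  fps_coef (fps_mul f g) m =
  \sum_(k : 'X_{1..n < b} | (k <= m)%MM) fps_coef f k * fps_coef g (m - k)%MM.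
Proof.
move=> mb /=; pose G k := fps_coef f k * fps_coef g (m - k)%MM.
pose P (k : 'X_{1..n}) := (k <= m)%MM.
pose Im : subFinType _ := 'X_{1..n < (mdeg m).+1}.
pose Ib : subFinType _ := 'X_{1..n < b}.
rewrite (ssrcomplements.big_sub_widen Im Ib P G) /=; last first.
  by move=> k /leq_trans; apply.
by apply: eq_bigl => k; rewrite /P; case: (boolP (k <= m)%MM) => //= km;
   rewrite ltnS lem_mdeg.
Qed.

Lemma fps_mulC : commutative fps_mul.
Proof.
move=> f g; apply: fpsP => m /=.
have pr (h : 'X_{1..n}) : (mdeg (m - h)%MM < (mdeg m).+1)%N.
  by rewrite ltnS mdegB.
pose r (k : 'X_{1..n < (mdeg m).+1}) := BMultinom (pr k).
have rK (h : 'X_{1..n}) : (h <= m)%MM -> (m - (m - h))%MM = h.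
  by move=> hm; rewrite submBA // addmC addmK.
rewrite (reindex_onto r r) /=; last by move=> h /rK hE; apply/eqP; rewrite eqE /= hE.
apply: eq_big => [k|k /andP[_ /eqP/(congr1 val) /= kE]].
  rewrite lem_subr eqE /=; apply/eqP/idP => [<-|/rK //]; exact: lem_subr.
by rewrite kE mulrC.
Qed.

Lemma fps_mulA : associative fps_mul.
Proof.
move=> f g h; apply: fpsP => m; set b := (mdeg m).+1.
rewrite [in RHS]fps_mulC !(@fps_coef_mul b) //.
have lt_b (k : 'X_{1..n}) : (mdeg (m - k)%MM < b)%N by rewrite ltnS mdegB.
pose T (i j : 'X_{1..n}) :=
  fps_coef f i * (fps_coef g (m - i - j)%MM * fps_coef h j).
transitivity (\sum_(i : 'X_{1..n < b} | (i <= m)%MM)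
                \sum_(j : 'X_{1..n < b} | (j <= m - i)%MM) T i j).
  apply: eq_bigr => i _; rewrite [in LHS]fps_mulC (fps_coef_mul _ _ (lt_b i)).
  by rewrite big_distrr /=; apply: eq_bigr => j _; rewrite /T [fps_coef h j * _]mulrC.
rewrite (exchange_big_dep (fun j : 'X_{1..n < b} => (j <= m)%MM)) /=; last first.
  by move=> i j _ /lepm_trans; apply; apply: lem_subr.
apply: eq_bigr => j jm.
rewrite -[X in _ * X]/(fps_coef (fps_mul f g) (m - j)%MM).
rewrite (fps_coef_mul _ _ (lt_b j)) big_distrr /=.
apply: eq_big => [i|i _].
  apply/andP/idP => [[/mnm_lepP im /mnm_lepP jmi]|imj].
    apply/mnm_lepP => l; move: (im l) (jmi l); rewrite !mnmBE; lia.
  have im : (i <= m)%MM by apply: lepm_trans imj (lem_subr _ _).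
  split=> //; apply/mnm_lepP => l; move/mnm_lepP: imj => /(_ l).
  move/mnm_lepP: im => /(_ l); move/mnm_lepP: jm => /(_ l).
  by rewrite !mnmBE; lia.
by rewrite /T !submDA addmC mulrA mulrC.
Qed.

Lemma fps_mul1 : left_id fps_one fps_mul.
Proof.
move=> f; apply: fpsP => m /=; rewrite (bigD1 (@bm0 n (mdeg m))) /=; last first.
  by apply/mnm_lepP => i; rewrite mnm0E.
rewrite eqxx mul1r subm0 big1 ?addr0 // => k /andP[_ kN0].
have -> : (k == 0%MM :> 'X_{1..n}) = false by exact: negPf kN0.
by rewrite mul0r.
Qed.

Lemma fps_mulDl : left_distributive fps_mul +%R.
Proof.
move=> f g h; apply: fpsP => m /=; rewrite -big_split /=.
by apply: eq_bigr => k _; rewrite mulrDl.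
Qed.

HB.instance Definition _ := GRing.Zmodule_isComPzRing.Build fps
  fps_mulA fps_mulC fps_mul1 fps_mulDl.

Definition fps_var (i : 'I_n) : fps := Fps (fun m => (m == U_(i)%MM)%:R).

End PowerSeries.

Section PrincipalQuotient.
Variables (A : comPzRingType) (f : A).

Definition principal : {pred A} := fun g => `[< exists h, g = h * f >].

Lemma principal_zmod_closed : zmod_closed principal.
Proof.
split=> [|_ _ /asboolP[x ->] /asboolP[y ->]]; apply/asboolP.
  by exists 0; rewrite mul0r.
by exists (x - y); rewrite mulrBl.
Qed.

HB.instance Definition _ :=
  GRing.isZmodClosed.Build A principal principal_zmod_closed.

Lemma principalMl a g : g \in principal -> a * g \in principal.
Proof. by move=> /asboolP[h ->]; apply/asboolP; exists (a * h); rewrite mulrA. Qed.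

Definition quo_principal := {ideal_quot principal}.

HB.instance Definition _ := GRing.Zmodule.on quo_principal.

Local Notation pi := (\pi_{ideal_quot principal}).

Lemma quo_principalE (x y : A) : (pi x == pi y) = (x - y \in principal).
Proof. by rewrite Quotient.idealrBE. Qed.

Definition quo_one : quo_principal := pi 1.
Definition quo_mul (x y : quo_principal) : quo_principal := pi (repr x * repr y).

Lemma quo_mulE (x y : A) : quo_mul (pi x) (pi y) = pi (x * y).
Proof.
have E (z : A) : repr (pi z) - z \in principal by rewrite -quo_principalE reprK.
apply/eqP; rewrite quo_principalE.
rewrite -[X in X - _](subrK (repr (pi x) * y)) -mulrBr -addrA -mulrBl.
by rewrite rpredD //; last rewrite mulrC; rewrite principalMl ?E.
Qed.

Lemma quo_mulA : associative quo_mul.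
Proof.
elim/quotW=> x; elim/quotW=> y; elim/quotW=> z.
by rewrite (quo_mulE x y) (quo_mulE y z) !quo_mulE mulrA.
Qed.
Lemma quo_mulC : commutative quo_mul.
Proof. by elim/quotW=> x; elim/quotW=> y; rewrite !quo_mulE mulrC. Qed.
Lemma quo_mul1 : left_id quo_one quo_mul.
Proof. by elim/quotW=> x; rewrite quo_mulE mul1r. Qed.
Lemma quo_mulDl : left_distributive quo_mul +%R.
Proof.
elim/quotW=> x; elim/quotW=> y; elim/quotW=> z.
by rewrite (quo_mulE x z) (quo_mulE y z) -!raddfD quo_mulE mulrDl.
Qed.

HB.instance Definition _ := GRing.Zmodule_isComPzRing.Build quo_principal
  quo_mulA quo_mulC quo_mul1 quo_mulDl.

End PrincipalQuotient.

Section Stability.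
Variables (F : realType) (R : comPzRingType).

(* fps 1 R is R[[T]]. *)
Definition semistable : Prop := lech_mumford F (fps 1 R) = 1%:E.

Definition stable : Prop :=
  semistable /\ ~ exists I : set (fps 1 R),
      primary_to_max I /\ (lech_ratio F I)%:E = lech_mumford F (fps 1 R).

End Stability.

Definition normal_crossing (K : fieldType) (d : nat) : comPzRingType :=
  quo_principal (\prod_(i < d) fps_var K i).

(* Main.v *)
(* Write the ring as a quotient of K[[x_1, ..., x_n]] by f = x_1 ... x_d, with
   n = d for R and n = d + 1 for R[[T]] (the last variable being T). Order the
   monomials by degree and then lexicographically, and let in(J) be the set of
   the smallest monomials of the elements of J. Lengths are numbers of monomials
   outside in(J), and in(I^m) contains the m-fold sums of in(I); hence e(I) is at
   most its value for the monomial ideal in(I), and one has to count exponents.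

   Upper bound for R[[T]]. On the face u_i = 0, round the d - 1 coordinates of u/m
   (other than T) down and up with m staggered offsets. This writes u, up to its
   T-coordinate, as a sum of m lattice points, so a face exponent outside the
   m-fold sums lies below the sum of the corresponding T-heights of in(I). A
   point p outside in(I) with z zeros among its first d coordinates thereby
   contributes at most m^d / z asymptotically to each of its z faces, so m^d in
   total, which gives e(I) <= d! l(R[[T]]/I). Reversing the offsets in one
   coordinate lowers the contribution of p = 0 to m^d / (d - 1), which is strict
   for d >= 3.

   Lower bounds come from the powers of the maximal ideal, whose lengths are
   computed exactly; for R and d >= 2 the second coefficient of the Hilbert
   polynomial makes the ratio exceed 1 for a large power.

   The Krull dimension is at most n - 1 because the Hilbert function of
   K[[x]]/P loses one degree of growth at each step of a chain of primes
   (Artin-Rees), and starts with growth of order n - 1 as soon as f is in P. *)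
Require Import Defs.
From mathcomp Require Import all_boot all_order all_algebra reals.
From mathcomp Require Import mpoly zify ring lra.
From mathcomp Require Import boolp classical_sets functions.
From mathcomp Require Import constructive_ereal ereal topology normedtype sequences.

Set Implicit Arguments.
Unset Strict Implicit.
Unset Printing Implicit Defensive.

Import Order.TTheory GRing.Theory Num.Theory.
Import numFieldNormedType.Exports.

(** * Initial monomials *)

Section InitialMonomials.
Local Open Scope classical_set_scope.
Local Open Scope ring_scope.
Variables (n : nat) (K : fieldType).
Local Notation A := (fps n K).
Implicit Types (f g h : A) (u v w : 'X_{1..n}) (V W J : set A).

Lemma fps_coefD f g u : fps_coef (f + g) u = fps_coef f u + fps_coef g u.
Proof. by []. Qed.

Lemma fps_coefN f u : fps_coef (- f) u = - fps_coef f u.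
Proof. by []. Qed.

Lemma fps_coef0 u : fps_coef (0 : A) u = 0.
Proof. by []. Qed.

Lemma fps_coef1 u : fps_coef (1 : A) u = (u == 0%MM)%:R.
Proof. by []. Qed.

Lemma fps_coef_sum I (r : seq I) (P : pred I) (F : I -> A) u :
  fps_coef (\sum_(i <- r | P i) F i) u = \sum_(i <- r | P i) fps_coef (F i) u.
Proof. by elim/big_rec2: _ => // i x y _ <-. Qed.

Lemma fps_coefM f g u : fps_coef (f * g) u =
  \sum_(k : 'X_{1..n < (mdeg u).+1} | (k <= u)%MM)
     fps_coef f k * fps_coef g (u - k)%MM.
Proof. by []. Qed.

Definition cmono (c : K) u : A := Fps (fun v => if v == u then c else 0).

Lemma coef_cmonoM c u g v :
  fps_coef (cmono c u * g) v =
  if (u <= v)%MM then c * fps_coef g (v - u)%MM else 0.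
Proof.
rewrite fps_coefM /=; case: ifP => [uv|/negP uv]; last first.
  apply: big1 => k kv; case: eqP => [ku|_]; last by rewrite mul0r.
  by case: uv; rewrite -ku.
have b : (mdeg u < (mdeg v).+1)%N by rewrite ltnS lem_mdeg.
rewrite (bigD1 (BMultinom b)) //= eqxx big1 ?addr0 // => k /andP[_ kN].
by case: eqP => [ku|]; rewrite ?mul0r //; case/eqP: kN; apply/val_inj.
Qed.

Lemma cmono_1 : cmono 1 0%MM = 1 :> A.
Proof. by apply: fpsP => u /=; case: eqP. Qed.

Lemma cmonoM c e u v : cmono c u * cmono e v = cmono (c * e) (u + v)%MM.
Proof.
apply: fpsP => w; rewrite coef_cmonoM /=.
case: ifP => uw.
  have -> : (w - u == v)%MM = (w == (u + v)%MM).
    by rewrite addmC -[w in RHS](submK uw) eqm_add2r.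
  by case: eqP => _ //; rewrite mulr0.
by case: eqP => // wE; rewrite wE lem_addr in uw.
Qed.

Definition initial g u :=
  fps_coef g u != 0 /\ forall v, (v < u)%O -> fps_coef g v = 0.

Lemma initial_exists g : g != 0 -> exists u, initial g u.
Proof.
move=> g0; have [u gu] : exists u, fps_coef g u != 0.
  apply: contrapT => /forallNP gz; case/eqP: g0; apply: fpsP => u.
  by apply/eqP/negPn/negP; exact: gz.
elim/(well_founded_ind (@ltom_wf n)): u gu => u IH gu.
have [[v vu gv]|no] := pselect (exists2 v, (v < u)%O & fps_coef g v != 0).
  exact: IH vu gv.
exists u; split=> // v vu; apply/eqP/negPn/negP => gv.
by apply: no; exists v.
Qed.

Lemma initial_cmono u : initial (cmono 1 u) u.
Proof.
rewrite /initial /= eqxx; split; first exact: oner_neq0.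
by move=> v; case: eqP => // ->; rewrite ltxx.
Qed.

Lemma coef_lt_mul g h u v w :
  (forall k, (k < u)%O -> fps_coef g k = 0) ->
  (forall k, (k < v)%O -> fps_coef h k = 0) ->
  (w < (u + v)%MM)%O -> fps_coef (g * h) w = 0.
Proof.
move=> gu hv wuv; rewrite fps_coefM big1 // => k kw.
have [ku|uk] := ltP (val k) u; first by rewrite gu // mul0r.
have [kv|vk] := ltP (w - k)%MM v; first by rewrite (hv _ kv) mulr0.
have := lem_add uk vk; rewrite addmC [(k + (w - k))%MM]addmC submK //.
by rewrite [(v + u)%MM]addmC leNgt wuv.
Qed.

(** In the convolution at [u + v], an index below [u] kills the first factor and an index above [u]
    pushes the second one below [v]; only the product of the two initial coefficients survives. *)
Lemma initialM g h u v :
  initial g u -> initial h v -> initial (g * h) (u + v)%MM.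
Proof.
move=> [gu gl] [hv hl]; split; last by move=> w; apply: coef_lt_mul.
have b : (mdeg u < (mdeg (u + v)%MM).+1)%N by rewrite ltnS lem_mdeg // lem_addr.
rewrite fps_coefM (bigD1 (BMultinom b)) /= ?lem_addr // [X in fps_coef h X](_ : _ = v).
  2: by rewrite addmC addmK.
rewrite big1 ?addr0 ?mulf_neq0 // => k /andP[kw kN].
have [ku|uk|ku] := ltgtP (val k) u; first by rewrite gl // mul0r.
  have [kv|vk] := ltP (u + v - k)%MM v; first by rewrite (hl _ kv) mulr0.
  have := ltmc_le_add uk vk; rewrite [(k + _)%MM]addmC submK //.
  by rewrite ltxx.
by case/eqP: kN; apply/val_inj.
Qed.

(** Linear subspaces over [K], with scalars encoded as constant series: the pieces cut out by order
    or support conditions in the division and dimension arguments need not be ideals. *)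
Definition ksubspace V :=
  [/\ V 0, forall g h, V g -> V h -> V (g + h) &
      forall c g, V g -> V (cmono c 0%MM * g)].

Lemma ideal_ksubspace J : ideal J -> ksubspace J.
Proof. by case=> ? ? JM; split=> // c g; exact: JM. Qed.

Lemma ksubspaceB V g h : ksubspace V -> V g -> V h -> V (g - h).
Proof.
move=> [V0 VD VZ] Vg Vh; apply: VD => //.
have -> : - h = cmono (-1) 0%MM * h.
  apply: fpsP => u; rewrite coef_cmonoM subm0 mulN1r fps_coefN ifT //.
  by apply/mnm_lepP => i; rewrite mnm0E.
exact: VZ.
Qed.

Definition inm V : set 'X_{1..n} := [set u | exists2 g, V g & initial g u].

Lemma inmS V W : V `<=` W -> inm V `<=` inm W.
Proof. by move=> VW u [g Vg gu]; exists g => //; exact: VW. Qed.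

(** The [N]-th power of the maximal ideal of the power series ring, described by vanishing
    coefficients. *)
Definition ord_ge (N : nat) : set A :=
  [set g | forall u, (mdeg u < N)%N -> fps_coef g u = 0].

Lemma ord_geM N M g h : ord_ge N g -> ord_ge M h -> ord_ge (N + M) (g * h).
Proof.
move=> gN hM u uNM; rewrite fps_coefM big1 // => k ku.
have [kN|Nk] := ltnP (mdeg k) N; first by rewrite gN ?mul0r.
have [kM|Mk] := ltnP (mdeg (u - k)%MM) M; first by rewrite (hM _ kM) mulr0.
have := congr1 mdeg (submK ku); rewrite mdegD; lia.
Qed.

Lemma ord_ge0 g : ord_ge 0 g.
Proof. by []. Qed.

Lemma ord_ge_le N M : (N <= M)%N -> ord_ge M `<=` ord_ge N.
Proof. by move=> NM g gM u uN; apply: gM; exact: leq_trans uN NM. Qed.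

Lemma ideal_ord_ge N : ideal (ord_ge N).
Proof.
split=> [u //|g h gN hN u uN|a g gN].
  by rewrite fps_coefD gN // hN // addr0.
by rewrite -[N]add0n; apply: ord_geM.
Qed.

Lemma initial_ord_ge N g u : ord_ge N g -> initial g u -> (N <= mdeg u)%N.
Proof. by move=> gN [gu _]; rewrite leqNgt; apply: contra gu => /gN ->. Qed.

Lemma initial_ge N g u : initial g u -> (N <= mdeg u)%N -> ord_ge N g.
Proof.
move=> [_ gl] Nu v vN; apply: gl; apply: lt_mdeg_ltmc; exact: leq_trans vN Nu.
Qed.

Lemma cmono_ord_ge N c u : (N <= mdeg u)%N -> ord_ge N (cmono c u).
Proof. by move=> Nu v vN /=; case: eqP => // vu; move: vN; rewrite vu ltnNge Nu. Qed.

(* Subtracting multiples raises the initial monomial, until the order is N. *)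
Lemma inm_sub_eq V W N : ksubspace V -> ksubspace W -> V `<=` W ->
  ord_ge N `<=` V -> inm W `<=` inm V -> W `<=` V.
Proof.
move=> sV sW VW NV inWV g Wg; have [V0 VD VZ] := sV; have [W0 WD WZ] := sW.
have [->//|/initial_exists[u gu]] := eqVneq g 0.
(* The induction runs on the number of monomials of degree below [N] that are not smaller than the
   initial monomial [u]. *)
have [k] := ubnP #|[pred v : 'X_{1..n < N} | (u <= val v)%O]|.
elim: k => // k IH in g u Wg gu *; rewrite ltnS => uk.
have [Nu|uN] := leqP N (mdeg u); first exact/NV/(initial_ge gu).
have [h Vh hu] : inm V u by apply: inWV; exists g.
pose c := fps_coef g u / fps_coef h u; pose g' := g - cmono c 0%MM * h.
have Vch : V (cmono c 0%MM * h) by exact: VZ.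
have coefch v : fps_coef (cmono c 0%MM * h) v = c * fps_coef h v.
  by rewrite coef_cmonoM subm0 ifT //; apply/mnm_lepP => i; rewrite mnm0E.
have -> : g = g' + cmono c 0%MM * h by rewrite subrK.
apply: VD => //; have [->//|/initial_exists[u' gu']] := eqVneq g' 0.
apply: (IH g' u') => //; first by apply: ksubspaceB => //; exact: VW.
apply: leq_trans uk; apply: proper_card; apply/properP.
have uu' : (u < u')%O.
  rewrite ltNge; apply/negP => u'u; case: gu' => + _; rewrite fps_coefD fps_coefN coefch.
  move: u'u; rewrite le_eqVlt => /orP[/eqP ->|u'u].
    by rewrite /c divfK ?subrr ?eqxx //; case: hu.
  by rewrite gu.2 // hu.2 // mulr0 subrr eqxx.
split; first by apply/fintype.subsetP => v; rewrite !inE; apply: le_trans; exact: ltW.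
by exists (BMultinom uN); rewrite !inE //= -ltNge.
Qed.

End InitialMonomials.

(** Induction on the number [k] of coordinates compared. A basis [F] for the first [k] serves every
    [u] whose next coordinate reaches the maximum [B] over [F]; each smaller value [b] of that
    coordinate is a slice with its own finite basis [G b]. *)
Lemma dickson n (M : set 'X_{1..n}) : exists F : seq 'X_{1..n},
  (forall u, u \in F -> M u) /\
  (forall u, M u -> exists2 v, v \in F & (v <= u)%MM).
Proof.
suff H k : forall M : set 'X_{1..n}, exists F : seq 'X_{1..n},
    (forall u, u \in F -> M u) /\
    (forall u, M u -> exists2 v, v \in F & forall i : 'I_n, i < k -> v i <= u i).
  have [F [FM MF]] := H n M; exists F; split=> // u /MF[v vF vu].
  by exists v => //; apply/mnm_lepP => i; exact: vu.
elim: k => [|k IH] {}M.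
  have [[u Mu]|no] := pselect (exists u, M u); last first.
    by exists [::]; split=> // u Mu; case: no; exists u.
  exists [:: u]; split=> [v|v _]; first by rewrite inE => /eqP ->.
  by exists u; rewrite ?inE.
have [F [FM MF]] := IH M.
have [nk|kn] := leqP n k.
  exists F; split=> // u /MF[v vF vu]; exists v => // i _; apply: vu.
  exact: leq_trans (ltn_ord i) nk.
pose i0 := Ordinal kn.
have /choice[G GP] : forall b, exists G : seq 'X_{1..n},
    (forall u, u \in G -> M u /\ u i0 = b) /\
    (forall u, M u /\ u i0 = b ->
       exists2 v, v \in G & forall i : 'I_n, i < k -> v i <= u i).
  by move=> b; exact: (IH [set u | M u /\ u i0 = b]%classic).
pose B := \max_(v <- F) v i0.
exists (F ++ flatten [seq G b | b <- iota 0 B]); split=> [u|u Mu].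
  rewrite mem_cat => /orP[/FM//|/flatten_mapP[b _ uG]].
  by have [/(_ _ uG)[]] := GP b.
have [Bu|uB] := leqP B (u i0).
  have [v vF vu] := MF u Mu; exists v; first by rewrite mem_cat vF.
  move=> i; rewrite ltnS leq_eqVlt => /orP[/eqP ik|]; last exact: vu.
  have -> : i = i0 by apply/val_inj.
  by apply: leq_trans Bu; exact: (@leq_bigmax_seq _ F xpredT (fun v => v i0)).
have [_ /(_ u (conj Mu erefl))[v vG vu]] := GP (u i0).
exists v.
  rewrite mem_cat; apply/orP; right; apply/flatten_mapP; exists (u i0) => //.
  by rewrite mem_iota.
move=> i; rewrite ltnS leq_eqVlt => /orP[/eqP ik|]; last exact: vu.
have -> : i = i0 by apply/val_inj.
by have [/(_ _ vG)[_ ->]] := GP (u i0).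
Qed.

(** * Completeness and the Artin-Rees lemma *)

Section Completeness.
Local Open Scope classical_set_scope.
Local Open Scope ring_scope.
Variables (n : nat) (K : fieldType).
Local Notation A := (fps n K).
Implicit Types (f g h : A) (u v w : 'X_{1..n}) (V W J P Q : set A).

(** The coefficient of the limit at [u] is a finite sum, because the terms of index above [mdeg u]
    do not reach [u]. *)
Lemma fps_series (s : nat -> A) : (forall k, ord_ge k (s k)) ->
  exists t, forall M, ord_ge M (t - \sum_(k < M) s k).
Proof.
move=> sk; exists (Fps (fun u => \sum_(k < (mdeg u).+1) fps_coef (s k) u)) => M u uM.
rewrite fps_coefD fps_coefN fps_coef_sum /=; apply/eqP; rewrite subr_eq0; apply/eqP.
rewrite -!(big_mkord xpredT (fun k => fps_coef (s k) u)).
rewrite [RHS](big_cat_nat (leq0n _) uM) /= [X in _ = _ + X]big1_seq ?addr0 //.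
by move=> k; rewrite mem_index_iota => /andP[_ /andP[uk _]]; exact: sk.
Qed.

Lemma ord_ge_sum I (r : seq I) (p : pred I) (F : I -> A) N :
  (forall i, p i -> ord_ge N (F i)) -> ord_ge N (\sum_(i <- r | p i) F i).
Proof.
have [z D _] := @ideal_ord_ge n K N.
by move=> H; elim/big_ind: _.
Qed.

Lemma ord_ge_eq0 g : (forall N, ord_ge N g) -> g = 0.
Proof. by move=> gN; apply: fpsP => u; apply: (gN (mdeg u).+1). Qed.

Lemma ord_geB N g h : ord_ge N g -> ord_ge N h -> ord_ge N (g - h).
Proof. exact: (ksubspaceB (ideal_ksubspace (@ideal_ord_ge n K N))). Qed.

(** After scaling, [g] is [1 - r] with [r] of positive order, and the geometric series of [r]
    converges to its inverse. *)
Lemma fps_unit g : fps_coef g 0%MM != 0 -> exists h, g * h = 1.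
Proof.
move=> g0; pose c := cmono (fps_coef g 0%MM)^-1 0%MM : A; pose r := 1 - c * g.
have r1 : ord_ge 1 r.
  move=> u; rewrite ltnS leqn0 mdeg_eq0 => /eqP ->.
  rewrite fps_coefD fps_coefN coef_cmonoM lepm_refl subm0 mulVf //.
  by rewrite fps_coef1 eqxx subrr.
have rk k : ord_ge k (r ^+ k).
  elim: k => [//|k IH]; rewrite exprS -add1n; exact: ord_geM.
have [t tP] := fps_series rk.
exists (c * t); rewrite mulrA [g * c]mulrC.
have -> : c * g = 1 - r by rewrite /r subKr.
clearbody r.
apply/eqP; rewrite -subr_eq0; apply/eqP/ord_ge_eq0 => N.
have -> : (1 - r) * t - 1 = (1 - r) * (t - \sum_(k < N) r ^+ k) - r ^+ N.
  have E : (1 - r) * (\sum_(k < N) r ^+ k) = 1 - r ^+ N.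
    by rewrite -opprB mulNr -subrX1 opprB.
  by rewrite mulrBr E opprB -addrA [r ^+ N - 1]addrC addrK.
apply: ord_geB => //; rewrite -[N]add0n; exact: ord_geM.
Qed.

Definition addset V W : set A := [set z | exists x y, [/\ V x, W y & z = x + y]].

Lemma addsetl V W : ksubspace W -> V `<=` addset V W.
Proof. by move=> [W0 _ _] g Vg; exists g, 0; rewrite addr0. Qed.

Lemma addsetr V W : ksubspace V -> W `<=` addset V W.
Proof. by move=> [V0 _ _] g Wg; exists 0, g; rewrite add0r. Qed.

Lemma ksubspace_addset V W : ksubspace V -> ksubspace W -> ksubspace (addset V W).
Proof.
move=> [V0 VD VZ] [W0 WD WZ]; split.
- by exists 0, 0; rewrite addr0.
- move=> _ _ [x [y [Vx Wy ->]]] [x' [y' [Vx' Wy' ->]]].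
  by exists (x + x'), (y + y'); rewrite addrACA; split=> //; [exact: VD|exact: WD].
- move=> c _ [x [y [Vx Wy ->]]].
  by exists (cmono c 0%MM * x), (cmono c 0%MM * y); rewrite mulrDr;
    split=> //; [exact: VZ|exact: WZ].
Qed.

Lemma ideal_addset J J' : ideal J -> ideal J' -> ideal (addset J J').
Proof.
move=> iJ iJ'; have [V0 VD _] := ksubspace_addset (ideal_ksubspace iJ) (ideal_ksubspace iJ').
split=> // a _ [x [y [Jx Jy ->]]]; exists (a * x), (a * y); rewrite mulrDr; split=> //.
  by case: iJ => _ _; apply.
by case: iJ' => _ _; apply.
Qed.

Lemma initialD N g h u :
  initial g u -> (mdeg u < N)%N -> ord_ge N h -> initial (g + h) u.
Proof.
move=> [gu gl] uN hN; split; first by rewrite fps_coefD hN // addr0.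
move=> v vu; rewrite fps_coefD gl // hN ?addr0 //.
by apply: leq_ltn_trans uN; apply: lemc_mdeg; exact: ltW.
Qed.

Lemma inm_addset_ord_ge V N u : (mdeg u < N)%N ->
  inm (addset V (ord_ge N)) u -> inm V u.
Proof.
move=> uN [_ [x [y [Vx yN ->]]] zu]; exists x => //.
rewrite -[x](addrK y); apply: initialD zu uN _.
have [_ _ oM] := @ideal_ord_ge n K N.
by rewrite -mulN1r; exact: oM.
Qed.

(* Artin-Rees, by division with respect to a finite standard basis; the
   quotients converge because every step raises the order. *)
Lemma artin_rees J : ideal J -> exists c (F : seq 'X_{1..n}) (G : 'X_{1..n} -> A),
  (forall v, v \in F -> J (G v)) /\
  forall N h, J h -> ord_ge (N + c) h ->
    exists a : 'X_{1..n} -> A, (forall v, v \in F -> ord_ge N (a v)) /\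
      h = \sum_(v <- F) a v * G v.
Proof.
move=> iJ; have sJ := ideal_ksubspace iJ; have [J0 JD JM] := iJ.
have [F [uF FJ JF]] : exists F : seq 'X_{1..n}, [/\ uniq F,
    forall u, u \in F -> inm J u &
    forall u, inm J u -> exists2 v, v \in F & (v <= u)%MM].
  have [F [FJ JF]] := dickson (inm J).
  exists (undup F); split=> [|u|u /JF[v vF vu]]; first exact: undup_uniq.
    by rewrite mem_undup; exact: FJ.
  by exists v; rewrite ?mem_undup.
have /choice[G GP] : forall v, exists g, v \in F -> J g /\ initial g v.
  move=> v; have [/FJ[g Jg gv]|] := boolP (v \in F); first by exists g.
  by exists 0.
(* Dividing an element of order [M + c] by [G v], whose order is [mdeg v <= c], leaves a quotient of
   order at least [M]. *)
pose c := \max_(v <- F) mdeg v.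
have Fc v : v \in F -> (mdeg v <= c)%N.
  by move=> vF; exact: (@leq_bigmax_seq _ F xpredT (fun v => mdeg v)).
exists c, F, G; split=> [v /GP[]//|].
pose comb (a : 'X_{1..n} -> A) := \sum_(v <- F) a v * G v.
have combJ a : J (comb a).
  by rewrite /comb big_seq; elim/big_ind: _ => // v /GP[Jv _]; exact: JM.
have sO L : ksubspace (@ord_ge n K L) by exact/ideal_ksubspace/ideal_ord_ge.
have combO M a : (forall v, ord_ge (M + c - mdeg v) (a v)) -> ord_ge (M + c) (comb a).
  move=> aM; rewrite /comb big_seq; apply: ord_ge_sum => v vF.
  have -> : (M + c = (M + c - mdeg v) + mdeg v)%N by have := Fc v vF; lia.
  by apply: ord_geM => //; have [_ Gv] := GP v vF; exact: initial_ge Gv _.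
(* One division step: modulo order [M.+1 + c], the combinations [X] and the elements [Y] of [J] have
   the same initial monomials, so they coincide. The premises stand under the existential so that
   [choice] yields a total function. *)
have step (x : nat * A) : exists a, J x.2 -> ord_ge (x.1 + c) x.2 ->
    (forall v, ord_ge (x.1 + c - mdeg v) (a v)) /\ ord_ge (x.1.+1 + c) (x.2 - comb a).
  case: x => M h /=.
  pose W := [set comb a | a in [set a | forall v, ord_ge (M + c - mdeg v) (a v)]].
  have sW : ksubspace W.
    split.
    - exists (fun=> 0) => [v|]; first by have [] := sO (M + c - mdeg v)%N.
      by rewrite /comb big1 // => v _; rewrite mul0r.
    - move=> _ _ [a aM <-] [b bM <-]; exists (fun v => a v + b v) => [v|].
        by have [_ D _] := sO (M + c - mdeg v)%N; apply: D; [exact: aM|exact: bM].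
      by rewrite /comb -big_split; apply: eq_bigr => v _; rewrite mulrDl.
    - move=> e _ [a aM <-]; exists (fun v => cmono e 0%MM * a v) => [v|].
        by have [_ _ D] := sO (M + c - mdeg v)%N; apply: D; exact: aM.
      by rewrite /comb mulr_sumr; apply: eq_bigr => v _; rewrite mulrA.
  have sJO : ksubspace (J `&` ord_ge (M + c)).
    have [o0 oD oM] := sO (M + c)%N; have [j0 jD jM] := sJ.
    split=> [//|x y [? ?] [? ?]|e x [? ?]]; split; by [exact: jD|exact: oD|exact: jM|exact: oM].
  pose X := addset W (ord_ge (M.+1 + c)).
  pose Y := addset (J `&` ord_ge (M + c)) (ord_ge (M.+1 + c)).
  have sX : ksubspace X by exact: ksubspace_addset.
  have sY : ksubspace Y by exact: ksubspace_addset.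
  have XY : X `<=` Y.
    move=> _ [_ [y [[a aM <-] yo ->]]]; exists (comb a), y; split=> //; split=> //.
    exact: combO.
  have inYX : inm Y `<=` inm X.
    move=> u uY; have [Lu|uL] := leqP (M.+1 + c) (mdeg u).
      exists (cmono 1 u); last exact: initial_cmono.
      by apply: addsetr => //; exact: cmono_ord_ge.
    have [g [Jg gM] gu] := inm_addset_ord_ge uL uY.
    have Mu := initial_ord_ge gM gu.
    have [v vF vu] : exists2 v, v \in F & (v <= u)%MM by apply: JF; exists g.
    have [Jv Gv] := GP _ vF.
    exists (cmono 1 (u - v)%MM * G v); last first.
      by rewrite -[X in initial _ X](submK vu); apply: initialM => //; exact: initial_cmono.
    apply: addsetl => //; exists (fun w => if w == v then cmono 1 (u - v)%MM else 0).
      move=> w /=; case: eqP => [->|_]; last by have [] := sO (M + c - mdeg w)%N.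
      by apply: cmono_ord_ge; have := congr1 mdeg (submK vu); rewrite mdegD; lia.
    rewrite /comb (bigD1_seq v) //= eqxx big1 ?addr0 // => w /negPf ->.
    by rewrite mul0r.
  have YX := inm_sub_eq sX sY XY (addsetr sW) inYX.
  have [[Jh hM]|no] := pselect (J h /\ ord_ge (M + c) h); last first.
    by exists (fun=> 0) => Jh hM; case: no.
  have [_ [y [[a aM <-] yo E]]] : X h by apply/YX/addsetl.
  by exists a => _ _; split=> //; rewrite E [comb a + y]addrC addrK.
move=> N h Jh hN; have [a aP] := choice step.
(* [s k] is the remainder after [k] divisions and [b k v] the quotient of the [k]-th one. The orders
   of the quotients grow with [k], so their sums converge to [t v]. *)
pose fix s k := if k is k'.+1 then s k' - comb (a ((N + k')%N, s k')) else h.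
have sP k : J (s k) /\ ord_ge (N + k + c) (s k).
  elim: k => [|k [Jk Ok]] /=; first by rewrite addn0.
  have [_] := aP ((N + k)%N, s k) Jk Ok; rewrite addnS => ?; split=> //.
  exact: ksubspaceB.
pose b k v := a ((N + k)%N, s k) v.
have bP k v : v \in F -> ord_ge (N + k) (b k v).
  move=> vF; have [Jk Ok] := sP k; have [/(_ v) H _] := aP ((N + k)%N, s k) Jk Ok.
  by apply: ord_ge_le H => /=; have := Fc v vF; lia.
have /choice[t tP] : forall v, exists t, v \in F ->
    forall M, ord_ge M (t - \sum_(k < M) b k v).
  move=> v; have [vF|_] := boolP (v \in F); last by exists 0.
  have [k|t tP] := @fps_series (b^~ v); last by exists t.
  by apply: ord_ge_le (bP k v vF); exact: leq_addl.
exists t; split=> [v vF|].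
  rewrite -[t v](subrK (\sum_(k < N) b k v)); have [_ D _] := sO N; apply: D.
    exact: tP.
  by apply: ord_ge_sum => k _; apply: ord_ge_le (bP k v vF); exact: leq_addr.
apply/eqP; rewrite -subr_eq0; apply/eqP/ord_ge_eq0 => L.
have sE M : s M = h - \sum_(k < M) comb (b k).
  elim: M => [|M IH]; first by rewrite big_ord0 subr0.
  by rewrite big_ord_recr /= opprD addrA -IH.
have -> : h - comb t = s L - comb (fun v => t v - \sum_(k < L) b k v).
  rewrite sE -addrA -opprD; congr (_ - _); rewrite /comb exchange_big -big_split /=.
  by apply: eq_bigr => v _; rewrite -mulr_suml mulrBl addrC subrK.
apply: ord_geB; first by apply: ord_ge_le (sP L).2; lia.
rewrite /comb big_seq; apply: ord_ge_sum => v vF.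
by have := ord_geM (tP v vF L) (ord_ge0 (G v)); rewrite addn0.
Qed.

End Completeness.

(** * Hilbert functions along chains of primes *)

Section Dimension.
Local Open Scope classical_set_scope.
Local Open Scope ring_scope.
Variables (n : nat) (K : fieldType).
Local Notation A := (fps n K).
Implicit Types (f g h : A) (V W J P Q : set A).

(** Artin-Rees for [J = P + (g)]: if [g * x = p + y] with [y] of high order, then [y = q + z * g]
    with [q] in [P] and [z] of order at least [N]. Hence [g * (x - z)] is in [P], and [x - z] is too
    because [P] is prime. *)
Lemma colon_ord_ge P g : prime_ideal P -> ~ P g -> exists c, forall c' N x,
  (c <= c')%N -> addset P (ord_ge (N + c')) (g * x) -> addset P (ord_ge N) x.
Proof.
move=> [iP _ Pprime] Pg; have sP := ideal_ksubspace iP; have [P0 PD PM] := iP.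
pose J := [set z | exists p b, P p /\ z = p + b * g].
have iJ : ideal J.
  split; first by exists 0, 0; rewrite mul0r addr0.
    move=> _ _ [p [b [Pp ->]]] [q [e [Pq ->]]]; exists (p + q), (b + e).
    by rewrite mulrDl addrACA; split=> //; exact: PD.
  move=> a _ [p [b [Pp ->]]]; exists (a * p), (a * b).
  by rewrite mulrDr mulrA; split=> //; exact: PM.
have [c [F [G [FJ AR]]]] := artin_rees iJ.
exists c => c' N x cc' [p [y [Pp yN E]]].
have Jy : J y.
  exists (- p), x; split; first by rewrite -mulN1r; exact: PM.
  by rewrite [x * g]mulrC E addKr.
have yc : ord_ge (N + c) y by apply: ord_ge_le yN; rewrite leq_add2l.
have [a [aN yE]] := AR N y Jy yc.
have [q [z [Pq zN yE']]] : exists q z, [/\ P q, ord_ge N z & y = q + z * g].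
  have [o0 oD oM] := @ideal_ord_ge n K N.
  rewrite yE big_seq; elim/big_ind: _.
  - by exists 0, 0; rewrite mul0r addr0.
  - move=> _ _ [q [z [Pq zN ->]]] [q' [z' [Pq' zN' ->]]].
    exists (q + q'), (z + z'); rewrite mulrDl addrACA.
    by split=> //; [exact: PD|exact: oD].
  - move=> v vF; have [q [b [Pq ->]]] := FJ v vF.
    exists (a v * q), (b * a v); rewrite mulrDr mulrA [a v * b]mulrC.
    by split=> //; [exact: PM|apply: oM; exact: aN].
exists (x - z), z; split=> //; last by rewrite subrK.
have : P (g * (x - z)).
  rewrite mulrBr E yE' addrA [z * g]mulrC addrK; exact: PD.
by move=> /Pprime[].
Qed.

(** The standard monomials of degree below [N]. For an ideal [J] their number is the length of the
    quotient by [J + ord_ge N], so [std_count J] is the Hilbert function of the quotient by [J]. *)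
Definition std J N : pred 'X_{1..n < N} :=
  fun u : 'X_{1..n < N} => `[< ~ inm J (val u) >].
Arguments std J N u : clear implicits.

Lemma stdP J N (u : 'X_{1..n < N}) : reflect (~ inm J (val u)) (u \in std J N).
Proof. exact: asboolP. Qed.

Definition std_count J N := #|std J N|.

Lemma std_countS J J' N : J `<=` J' -> (std_count J' N <= std_count J N)%N.
Proof.
move=> JJ'; apply/subset_leq_card/fintype.subsetP => u.
by move=> /stdP uJ'; apply/stdP => uJ; exact: uJ' (inmS JJ' uJ).
Qed.

(** If no standard monomial were lost, [V] and [W] would have the same initial monomials, and
    [inm_sub_eq] would make them equal. *)
Lemma std_count_lt V W N : ksubspace V -> ksubspace W -> V `<` W ->
  ord_ge N `<=` V -> (std_count W N < std_count V N)%N.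
Proof.
move=> sV sW [VW WV] NV; apply/proper_card/properP; split.
  by apply/fintype.subsetP => u /stdP uW; apply/stdP => uV; exact: uW (inmS VW uV).
apply: contrapT => no; apply: WV; apply: (inm_sub_eq sV sW VW NV) => u uW.
have [Nu|uN] := leqP N (mdeg u).
  by exists (cmono 1 u); [exact/NV/cmono_ord_ge|exact: initial_cmono].
apply: contrapT => uV; apply: no; exists (BMultinom uN); first exact/stdP.
by apply/stdP; exact.
Qed.

(* Multiplication by [g] is injective on [A / P], and by Artin-Rees it shifts
   orders by a bounded amount only. *)
Lemma std_count_drop P Q : prime_ideal P -> ideal Q -> P `<` Q ->
  exists c, forall c' N, (c <= c')%N ->
    (std_count Q (N + c') + std_count P N <= std_count P (N + c'))%N.
Proof.
move=> pP iQ [PQ /existsNP[g /not_implyP[Qg Pg]]]; have [iP _ _] := pP.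
have [c cP] := colon_ord_ge pP Pg; exists c => c' N cc'.
have sO L : ksubspace (@ord_ge n K L) by exact/ideal_ksubspace/ideal_ord_ge.
have [sP sQ] := (ideal_ksubspace iP, ideal_ksubspace iQ).
set L := (N + c')%N; pose V := addset P (ord_ge L).
pose U (s : seq 'X_{1..n < N}) := [set g * p | p in [set p : A |
  forall w, w \notin map val s -> fps_coef p w = 0]].
pose T s := addset V (U s).
have sV : ksubspace V by exact: ksubspace_addset.
have sU s : ksubspace (U s).
  split.
  - by exists 0; rewrite ?mulr0.
  - move=> _ _ [p ps <-] [q qs <-]; exists (p + q); last by rewrite mulrDr.
    by move=> w ws; rewrite fps_coefD ps // qs // addr0.
  - move=> e _ [p ps <-]; exists (cmono e 0%MM * p); last by rewrite mulrCA.
    by move=> w ws; rewrite coef_cmonoM subm0 ps // mulr0; case: ifP.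
have sT s : ksubspace (T s) by exact: ksubspace_addset.
pose D := enum (std P N).
have DP u : u \in D -> ~ inm P (val u).
  by rewrite mem_enum => /stdP.
(* [T s] adds to [P + ord_ge L] the multiples [g * p] with [p] supported on [s]. If each standard
   monomial of [P] enlarges it strictly, then [T D], which lies in [Q + ord_ge L], has lost
   [std_count P N] standard monomials. *)
suff H s : uniq s -> {subset s <= D} ->
    (std_count (T s) L + size s <= std_count V L)%N.
  have -> : std_count P N = size D by rewrite /D -cardE.
  have VP : (std_count V L <= std_count P L)%N.
    by apply: std_countS; exact: addsetl.
  have QT : (std_count Q L <= std_count (T D) L)%N.
    apply: subset_leq_card; apply/fintype.subsetP => u.
    move=> /stdP uQ; apply/stdP => uT; apply: uQ.
    apply: (inm_addset_ord_ge (N := L)); first exact: bmdeg.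
    apply: inmS uT => _ [_ [_ [[x [y [Px yL ->]]] [p _ <-] ->]]].
    exists (x + g * p), y; rewrite addrAC; split=> //.
    by have [_ QD QM] := iQ; apply: QD; [exact: PQ|rewrite mulrC; exact: QM].
  apply: leq_trans VP; apply: leq_trans (H D (enum_uniq _) _) => //.
  by rewrite leq_add2r.
elim: s => [_ _|t s IH /= /andP[ts us] sD].
  by rewrite addn0; apply: std_countS; exact: addsetl.
have sD' : {subset s <= D} by move=> w ws; apply: sD; rewrite inE ws orbT.
apply: leq_trans (IH us sD'); rewrite addnS -addSn leq_add2r.
apply: std_count_lt => //; last first.
  by move=> x xL; apply: addsetl => //; exact: addsetr.
have sub (w : 'X_{1..n < N}) r : val w \notin map val r = (w \notin r).
  by rewrite mem_map //; exact: val_inj.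
split=> [_ [x [_ [Vx [p ps <-] ->]]]|].
  exists x, (g * p); split=> //; exists p => // w wN; apply: ps.
  by apply: contra wN; rewrite inE => ->; rewrite orbT.
move=> /(_ (g * cmono 1 (val t)))[].
  apply: addsetr => //; exists (cmono 1 (val t)) => // w /=.
  by rewrite inE negb_or => /andP[/negPf ->].
move=> x [_ [Vx [p ps <-] E]].
(* If the new multiple of [g] were already in [T s], the difference [cmono 1 (val t) - p] would lie
   in [P + ord_ge N]. All its monomials belong to [D], so its initial monomial would be both
   standard and initial for [P]. *)
have [q [r [Pq rN zE]]] : addset P (ord_ge N) (cmono 1 (val t) - p).
  by apply: (cP c') => //; rewrite mulrBr E addrK.
pose z := cmono 1 (val t) - p : A.
have zt : fps_coef z (val t) = 1.
  by rewrite fps_coefD fps_coefN /= eqxx ps ?subr0 // sub.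
have z0 : z != 0 by apply/eqP => z0; move: zt; rewrite z0 fps_coef0 => /eqP; rewrite eq_sym oner_eq0.
have [w zw] := initial_exists z0.
have [w' w'D ww'] : exists2 w' : 'X_{1..n < N}, w' \in D & w = val w'.
  case: zw => zw _; have [->|wt] := eqVneq w (val t).
    by exists t => //; apply: sD; rewrite inE eqxx.
  have [/mapP[w' w's ->]|ws] := boolP (w \in map val s).
    by exists w' => //; exact: sD'.
  by move: zw; rewrite fps_coefD fps_coefN /= (negPf wt) ps // subr0 eqxx.
case: (DP _ w'D); rewrite -ww'; exists q => //.
rewrite -[q](addrK r) -zE; apply: (initialD (N := N)) => //.
  by rewrite ww'; exact: bmdeg.
by have [_ _ oM] := @ideal_ord_ge n K N; rewrite -mulN1r; exact: oM.
Qed.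

Lemma std_count_gt0 P N : ideal P -> ~ P 1 -> (0 < N)%N -> (0 < std_count P N)%N.
Proof.
move=> [_ _ PM] P1 N0; apply/card_gt0P.
have b : (mdeg (0%MM : 'X_{1..n}) < N)%N by rewrite mdeg0.
exists (BMultinom b); apply/stdP => -[g Pg [g0 _]].
by have [h gh] := fps_unit g0; apply: P1; rewrite -gh mulrC; exact: PM.
Qed.

(** Going down from the top prime, [std_count_drop] bounds the growth of each Hilbert function below
    by the next one. This is Pascal's rule, so [j] steps below the top the growth is at least that
    of ['C(T, j)]. *)
Lemma prime_chain_bin (c : nat -> set A) k :
  strict_chain (@prime_ideal A) k c ->
  exists2 e, (0 < e)%N & forall j, (j <= k)%N -> forall T,
    ('C(T, j) <= std_count (c (k - j)%N) (e * T + 1))%N.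
Proof.
move=> [cp cs].
have [e e0 eP] : exists2 e, (0 < e)%N & forall i, (i < k)%N -> forall N,
    (std_count (c i.+1) (N + e) + std_count (c i) N <= std_count (c i) (N + e))%N.
  have /choice[b bP] : forall i, exists b, (i < k)%N -> forall c' N, (b <= c')%N ->
    (std_count (c i.+1) (N + c') + std_count (c i) N <= std_count (c i) (N + c'))%N.
    move=> i; have [ik|_] := boolP (i < k)%N; last by exists 0%N.
    have [|||b bP] := @std_count_drop (c i) (c i.+1); last by exists b.
    - exact/cp/ltnW.
    - by have [] := cp i.+1 ik.
    - exact: cs.
  (* A common shift for all steps of the chain; the successor makes it positive. *)
  exists (\max_(i < k) b i).+1 => // i ik N; apply: bP => //; apply: ltnW; rewrite ltnS.
  exact: (leq_bigmax (Ordinal ik)).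
exists e => //; elim=> [_ T|j IHj jk].
  have [iP P1 _] := cp k (leqnn k).
  by rewrite subn0 bin0; apply: std_count_gt0 => //; rewrite addn1.
elim=> [//|T IHT]; rewrite binS addnC.
have ik : (k - j.+1 < k)%N by lia.
have := eP _ ik (e * T + 1)%N; rewrite subnSK //.
have -> : (e * T + 1 + e = e * T.+1 + 1)%N by lia.
apply: leq_trans; apply: leq_add; last exact: IHT.
by apply: leq_trans (IHj (ltnW jk) T.+1); exact: leq_bin2l.
Qed.

End Dimension.
Arguments std {n K} J N u.

Lemma card_union_bound (T I : finType) (D : pred T) (r : pred I) (B : I -> pred T) :
  (forall x, x \in D -> exists2 i, r i & B i x) -> #|D| <= \sum_(i | r i) #|B i|.
Proof.
move=> DB; rewrite -sum1_card.
apply: (@leq_trans (\sum_(x in D) \sum_(i | r i) B i x)).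
  by apply: leq_sum => x /DB[i ri Bi]; rewrite (bigD1 i) //= Bi.
rewrite exchange_big; apply: leq_sum => i _.
rewrite -[X in _ <= X]sum1_card big_mkcond [X in _ <= X]big_mkcond /=.
by apply: leq_sum => x _; rewrite -[x \in B i]/(B i x); case: (B i x); case: ifP.
Qed.

(** * Krull dimension *)

Lemma max_chain_lengthE (R : comPzRingType) (P : set (set R)) k :
  (exists c, strict_chain P k c) ->
  (forall l c, strict_chain P l c -> l <= k) -> max_chain_length P = k.
Proof.
move=> ck ub; rewrite /max_chain_length.
set S := [set _ | _]%classic.
have Sk : S k by [].
have ubk : ubound S k by move=> l [c /ub].
rewrite /supremum; case: ifPn => [/eqP S0|_]; first by rewrite S0 in Sk.
case: xgetP => [l -> [ubl lbl]|/(_ k)[]]; last first.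
  by split=> // l; apply.
by apply/eqP; rewrite eqn_leq; apply/andP; split; [exact: lbl|exact: ubl].
Qed.

Section KrullDimension.
Local Open Scope classical_set_scope.
Local Open Scope ring_scope.
Variables (n : nat) (K : fieldType).
Local Notation A := (fps n K).
Implicit Types (f g h : A) (V W J P Q : set A).

(* The ideal generated by the monomial x_0 ... x_(d-1). *)
Definition ncker d : set A :=
  [set g | forall (u : 'X_{1..n}) (i : 'I_n), (i < d)%N -> u i = 0%N -> fps_coef g u = 0].

Lemma ideal_ncker d : ideal (ncker d).
Proof.
split=> [//|g h gd hd u i id ui|a g gd u i id ui].
  by rewrite fps_coefD (gd u i) // (hd u i) // addr0.
rewrite fps_coefM big1 // => k _; rewrite (gd _ i) ?mulr0 // mnmBE ui.
by rewrite sub0n.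
Qed.

Lemma inm_ncker d u : inm (ncker d) u <-> forall i : 'I_n, (i < d)%N -> u i != 0%N.
Proof.
split=> [[g gd [gu _]] i id|ud].
  by apply: contra gu => /eqP ui; rewrite (gd u i).
exists (cmono 1 u); last exact: initial_cmono.
move=> v i id vi /=; case: eqP => // vu.
by have := ud i id; rewrite -vu vi.
Qed.

Lemma card_coord0 (i : 'I_n) N :
  (#|[pred u : 'X_{1..n < N} | val u i == 0%N]| <= N ^ n.-1)%N.
Proof.
case: N => [|N].
  by rewrite eq_card0 // => u; have := bmdeg u; rewrite ltn0.
have uN (u : 'X_{1..n < N.+1}) j : (val u j < N.+1)%N.
  apply: leq_ltn_trans (bmdeg u); rewrite mdegE (bigD1 j) //=; exact: leq_addr.
pose F (u : 'X_{1..n < N.+1}) : {ffun 'I_n.-1 -> 'I_N.+1} :=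
  [ffun j => Ordinal (uN u (lift i j))].
rewrite -[X in (X ^ _)%N]card_ord -[X in (_ ^ X)%N]card_ord -card_ffun.
apply: (@leq_card_in _ _ F).
move=> u v /eqP ui /eqP vi /ffunP uv; apply/val_inj/mnmP => j.
have [->|ij] := eqVneq j i; first by rewrite ui vi.
rewrite eq_sym in ij; have [k -> _] := unlift_some ij.
by have := congr1 val (uv k); rewrite !ffunE.
Qed.

(** A standard monomial has a vanishing exponent, and each coordinate hyperplane carries at most
    [N ^ n.-1] of them. *)
Lemma std_count_ncker d J N : ncker d `<=` J -> (std_count J N <= n * N ^ n.-1)%N.
Proof.
move=> dJ; rewrite -[X in (X * _)%N]card_ord -sum_nat_const.
apply: (@leq_trans (\sum_(i < n) #|[pred u : 'X_{1..n < N} | val u i == 0%N]|)).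
  2: by apply: leq_sum => i _; exact: card_coord0.
apply: card_union_bound => u /stdP uJ; apply: contrapT => no; apply: uJ.
apply: inmS dJ _ _; apply/inm_ncker => i id; apply/negP => ui; apply: no.
by exists i.
Qed.

Lemma bin_poly_contra e : (0 < n)%N ->
  ~ (forall T, ('C(T, n) <= n * (e * T + 1) ^ n.-1)%N).
Proof.
(* With [T = n + D], the right side times [n!] is at most [D * D.+1 ^ n.-1], which is less than
   [D.+1 ^ n], a lower bound for the falling factorial of [T]. *)
move=> n0 H; pose D := (n`! * (n * (e * n + 1) ^ n.-1))%N.
have := H (n + D)%N; apply/negP; rewrite -ltnNge.
rewrite -(ltn_pmul2r (fact_gt0 n)) bin_ffact.
have lb m k : ((k.+1) ^ m <= (m + k) ^_ m)%N.
  elim: m => [//|m IH]; rewrite addSn ffactnS expnS leq_mul //=.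
  by rewrite ltnS leq_addl.
apply: leq_trans (lb n D).
rewrite -[X in (D.+1 ^ X)%N](prednK n0) expnS.
apply: (@leq_ltn_trans (D * D.+1 ^ n.-1)%N); last first.
  by rewrite ltn_pmul2r // expn_gt0.
have le : ((e * (n + D) + 1) ^ n.-1 <= (e * n + 1) ^ n.-1 * D.+1 ^ n.-1)%N.
  rewrite -expnMn; case: n.-1 => // p; rewrite leq_exp2r //; nia.
have -> : (D * D.+1 ^ n.-1 = n * ((e * n + 1) ^ n.-1 * D.+1 ^ n.-1) * n`!)%N.
  rewrite {1}/D; move: (D.+1 ^ n.-1)%N (n`!) ((e * n + 1) ^ n.-1)%N => x y z; lia.
by rewrite leq_mul2r leq_mul2l le !orbT.
Qed.

(** A chain of length [n] or more would give some prime containing [ncker d] a Hilbert function of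
    degree at least [n], whereas [std_count_ncker] allows only degree [n - 1]. *)
Lemma prime_chain_ncker d k (c : nat -> set A) : (0 < n)%N ->
  strict_chain [set P : set A | prime_ideal P /\ ncker d `<=` P] k c -> (k <= n.-1)%N.
Proof.
move=> n0 [cP cs]; rewrite leqNgt; apply/negP => nk.
have {nk} nk : (n <= k)%N by rewrite -(prednK n0).
have chain : strict_chain (@prime_ideal A) k c.
  by split=> // i ik; have [] := cP i ik.
have [e e0 eP] := prime_chain_bin chain.
apply: (@bin_poly_contra e n0) => T.
apply: leq_trans (eP n nk T) _; apply: (@std_count_ncker d).
by have [] := cP (k - n)%N (leq_subr _ _).
Qed.

(** The substitution that sets the first [k] variables to 0. It is multiplicative, and the ring is a
    domain, so its kernel [coord_ideal k] is prime. *)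
Definition restr (k : nat) g : A :=
  Fps (fun u : 'X_{1..n} => if [forall i : 'I_n, (i < k)%N ==> (u i == 0%N)]
                            then fps_coef g u else 0).

Lemma restrM k g h : restr k (g * h) = restr k g * restr k h.
Proof.
apply: fpsP => u; rewrite [RHS]fps_coefM /=; case: ifP => [/forallP uk|/negbT].
  apply: eq_bigr => v vu.
  have vk (i : 'I_n) : (i < k)%N -> val v i = 0%N.
    move=> ik; have /implyP/(_ ik)/eqP ui := uk i.
    by apply/eqP; rewrite -leqn0 -ui; move/mnm_lepP: vu; apply.
  rewrite !ifT //; apply/forallP => i; apply/implyP => ik.
    by rewrite mnmBE vk // subn0; have /implyP/(_ ik) := uk i.
  by rewrite vk.
rewrite negb_forall => /existsP[i]; rewrite negb_imply => /andP[ik ui].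
rewrite big1 // => v vu; case: ifP => [/forallP/(_ i)/implyP/(_ ik)/eqP vi|_];
  last by rewrite mul0r.
rewrite ifF ?mulr0 //; apply/negbTE; rewrite negb_forall; apply/existsP; exists i.
by rewrite ik /= mnmBE vi subn0.
Qed.

Lemma fps_mulf_eq0 g h : g * h = 0 -> g = 0 \/ h = 0.
Proof.
move=> gh; have [->|/initial_exists[u gu]] := eqVneq g 0; first by left.
have [->|/initial_exists[v hv]] := eqVneq h 0; first by right.
by case: (initialM gu hv); rewrite gh eqxx.
Qed.

Definition coord_ideal k : set A := [set g | restr k g = 0].

Lemma prime_coord_ideal k : prime_ideal (coord_ideal k).
Proof.
have rD g h : restr k (g + h) = restr k g + restr k h.
  by apply: fpsP => u /=; case: ifP; rewrite ?addr0.
split; first split.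
- by apply: fpsP => u /=; case: ifP.
- by move=> g h gk hk; rewrite /coord_ideal /= rD gk hk addr0.
- by move=> a g gk; rewrite /coord_ideal /= restrM gk mulr0.
- move=> /(congr1 (fun g : A => fps_coef g 0%MM)) /=.
  rewrite eqxx ifT => [/eqP|]; first by rewrite oner_eq0.
  by apply/forallP => i; rewrite mnm0E eqxx implybT.
- by move=> g h; rewrite /coord_ideal /= restrM => /fps_mulf_eq0.
Qed.

Lemma krull_ncker d : (0 < d <= n)%N ->
  max_chain_length [set P : set A | prime_ideal P /\ ncker d `<=` P] = n.-1.
Proof.
move=> /andP[d0 dn]; have n0 := leq_trans d0 dn.
apply: max_chain_lengthE => [|k c]; last exact: prime_chain_ncker.
(* The chain of the ideals generated by [x_0], by [x_0, x_1], and so on up to all [n] variables. The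
   index starts at 1 because the first ideal has to contain [ncker d]. *)
exists (fun k => coord_ideal k.+1); split=> i ik.
  split; first exact: prime_coord_ideal.
  move=> g gd; apply: fpsP => u /=; case: ifP => // /forallP uk.
  apply: (gd u (Ordinal n0)) => //.
  by have /implyP/(_ (ltn0Sn i))/eqP := uk (Ordinal n0).
split=> [g gi|].
  apply: fpsP => u /=; case: ifP => // /forallP uk.
  have /(congr1 (fun g : A => fps_coef g u)) /= := gi.
  rewrite ifT //; apply/forallP => j; apply/implyP => ji.
  by have /implyP := uk j; apply; rewrite ltnW.
have i1n : (i.+1 < n)%N by lia.
move=> sub; have /sub : coord_ideal i.+2 (cmono 1 U_(Ordinal i1n)%MM).
  apply: fpsP => u /=; case: ifP => // /forallP /(_ (Ordinal i1n)).
  rewrite /= ltnSn /= => ui; case: eqP => // uE.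
  by move: ui; rewrite uE mnm1E eqxx.
move=> /(congr1 (fun g : A => fps_coef g U_(Ordinal i1n)%MM)) /=.
rewrite eqxx ifT => [/eqP|]; first by rewrite oner_eq0.
apply/forallP => j; apply/implyP => ji; rewrite mnm1E; apply/eqP.
by case: eqP => // /(congr1 val) /= ij; move: ji; rewrite -ij ltnn.
Qed.

End KrullDimension.

(** * Lengths in the quotient ring *)

Section SurjectionChains.
Local Open Scope classical_set_scope.
Variables (A S : comPzRingType) (phi : A -> S).
Hypothesis phi_surj : forall s, exists g, phi g = s.

Lemma max_chain_length_surj (P : set (set S)) (Q : set (set A)) :
  (forall J, P J -> Q (phi @^-1` J)) ->
  (forall I, Q I -> P (phi @` I)) ->
  (forall I, Q I -> phi @^-1` (phi @` I) `<=` I) ->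
  max_chain_length P = max_chain_length Q.
Proof.
move=> PQ QP QK; rewrite /max_chain_length; congr supremum.
apply/seteqP; split=> k [c [cP cs]].
  exists (fun i => phi @^-1` (c i)); split=> [i ik|i ik]; first exact/PQ/cP.
  have [cc /existsNP[s /not_implyP[cs' cs'']]] := cs i ik.
  split=> [g|sub]; first exact: cc.
  by have [g gs] := phi_surj s; apply: cs''; rewrite -gs; apply: sub; rewrite /= gs.
exists (fun i => phi @` (c i)); split=> [i ik|i ik]; first exact/QP/cP.
have [cc ncc] := cs i ik; split=> [_ [g gc <-]|sub]; first by exists g => //; exact: cc.
apply: ncc => g gc; apply: QK; first exact/cP/ltnW.
by apply: sub; exists g.
Qed.

End SurjectionChains.

Section IdealPowers.
Local Open Scope classical_set_scope.
Local Open Scope ring_scope.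
Variable R : comPzRingType.
Implicit Types I J L : set R.

Lemma ideal_smallest (G : set R) : ideal (smallest (@ideal R) G).
Proof.
split=> [L [[L0 _ _] _] //|x y Gx Gy L LG|a x Gx L LG].
  by case: (LG) => -[_ D _] _; apply: D; [exact: Gx|exact: Gy].
by case: (LG) => -[_ _ M] _; apply: M; exact: Gx.
Qed.

Lemma ideal_mulP I J x y : I x -> J y -> ideal_mul I J (x * y).
Proof. by move=> Ix Jy L [_]; apply; exists x, y. Qed.

Lemma ideal_mul_sub I J L : ideal L ->
  (forall x y, I x -> J y -> L (x * y)) -> ideal_mul I J `<=` L.
Proof. by move=> iL IJ z; apply; split=> // _ [x [y [Ix Jy ->]]]; exact: IJ. Qed.

Lemma ideal_setT : ideal (@setT R).
Proof. by split. Qed.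

Lemma ideal_ideal_exp I m : ideal (ideal_exp I m).
Proof. by case: m => [|m]; [exact: ideal_setT|exact: ideal_smallest]. Qed.

Lemma ideal_exp_sub I m : ideal I -> ideal_exp I m.+1 `<=` I.
Proof.
move=> iI; apply: ideal_mul_sub => // x y Ix _; rewrite mulrC.
by case: iI => _ _; apply.
Qed.

Lemma ideal_exp_pow I m x : I x -> ideal_exp I m (x ^+ m).
Proof.
by move=> Ix; elim: m => [//|m IH]; rewrite exprS; exact: ideal_mulP.
Qed.

End IdealPowers.

Section Lengths.
Local Open Scope classical_set_scope.
Local Open Scope ring_scope.
Variables (n : nat) (K : fieldType).
Local Notation A := (fps n K).
Implicit Types (f g h : A) (V W J P Q : set A).

(** Adjoin to [J] the ideal [U] of all series without terms below the largest standard monomial [w].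
    This removes exactly [w] from the standard monomials; iterate. *)
Lemma ideal_chain_exists J N : ideal J -> ord_ge N `<=` J ->
  exists c, strict_chain [set I | ideal I /\ J `<=` I] (std_count J N) c.
Proof.
have [k] := ubnP (std_count J N); elim: k J => // k IH J; rewrite ltnS => Jk iJ NJ.
case: (posnP (std_count J N)) => [->|].
  by exists (fun=> J); split=> [i _|i] //; split.
move=> J0; have /card_gt0P[w0 w0J] := J0.
pose w := [arg max_(w > w0 | w \in std J N) val w]%O.
have [/stdP wJ wmax] : w \in std J N /\ forall v, v \in std J N -> (val v <= val w)%O.
  by rewrite /w; case: arg_maxP => // v vJ vm; split.
pose U : set A := [set g | forall v, (v < val w)%O -> fps_coef g v = 0].
have iU : ideal U.
  split=> [//|g h gU hU v vw|a g gU v vw]; first by rewrite fps_coefD gU // hU // addr0.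
  apply: (@coef_lt_mul _ _ _ _ 0%MM (val w)) => //; last by rewrite add0m.
  by move=> u; rewrite ltNge le0m.
pose J' := addset J U.
have iJ' : ideal J' by exact: ideal_addset.
have JJ' : J `<` J'.
  split; first exact/addsetl/ideal_ksubspace.
  move=> sub; apply: wJ; exists (cmono 1 (val w)); last exact: initial_cmono.
  apply: sub; apply: addsetr; first exact: ideal_ksubspace.
  by move=> v /= vw; case: eqP => // vE; move: vw; rewrite vE ltxx.
have NJ' : ord_ge N `<=` J' by exact: subset_trans NJ JJ'.1.
have lt : (std_count J' N < std_count J N)%N.
  by apply: std_count_lt => //; exact: ideal_ksubspace.
have ge : (std_count J N <= (std_count J' N).+1)%N.
  rewrite /std_count (cardD1 w) addnC -addn1 leq_add ?leq_b1 //.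
  apply/subset_leq_card/fintype.subsetP => v /andP[/= vw vJ].
  have vltw : (val v < val w)%O.
    by rewrite lt_neqAle wmax // andbT; apply: contra vw => /eqP/val_inj ->.
  have /stdP vJ' := vJ; apply/stdP => -[_ [x [y [Jx yU ->]]] [xy xyl]].
  apply: vJ'; exists x => //; split.
    by move: xy; rewrite fps_coefD (yU _ vltw) addr0.
  move=> u uv; have := xyl u uv; rewrite fps_coefD (yU u) ?addr0 //.
  exact: lt_trans uv vltw.
have E : std_count J N = (std_count J' N).+1 by apply/eqP; rewrite eqn_leq ge.
have [|c [cP cs]] := IH J' _ iJ' NJ'; first by rewrite -ltnS; exact: leq_trans lt Jk.
exists (fun i => if i is i'.+1 then c i' else J); rewrite E; split.
  case=> [_|i ik]; first by split.
  by have [ic J'c] := cP i ik; split=> // x /JJ'.1 /J'c.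
case=> [_|i ik]; last exact: cs.
have [_ J'c] := cP 0%N (leq0n _).
split; first exact: subset_trans JJ'.1 J'c.
move=> cJ; apply: JJ'.2; exact: subset_trans J'c cJ.
Qed.

(** No chain is longer than the one just built, since every strict inclusion costs at least one
    standard monomial. *)
Lemma quo_length_std J N : ideal J -> ord_ge N `<=` J -> quo_length J = std_count J N.
Proof.
move=> iJ NJ; apply: max_chain_lengthE; first exact: ideal_chain_exists.
move=> l c [cP cs].
suff H i : (i <= l)%N -> (std_count (c i) N + i <= std_count J N)%N.
  by apply: leq_trans (H l (leqnn l)); exact: leq_addl.
elim: i => [_|i IH il].
  by rewrite addn0; have [_ Jc] := cP 0%N (leq0n _); exact: std_countS.
apply: leq_trans (IH (ltnW il)); rewrite addnS -addSn leq_add2r.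
have [[ic Jc] [ic' _]] := (cP i (ltnW il), cP i.+1 il).
by apply: std_count_lt; [exact: ideal_ksubspace..|exact: cs|exact: subset_trans NJ Jc].
Qed.

(** By pigeonhole a monomial of degree above [n * B] has some exponent at least [B]. The function
    [pk] chooses one such variable per monomial, so each term of [g] enters exactly one of the
    multiples [gi i]. *)
Lemma pure_powers_ord_ge J : ideal J ->
  (forall i : 'I_n, exists a, J (cmono 1 (U_(i) *+ a)%MM)) ->
  exists N, ord_ge N `<=` J.
Proof.
move=> iJ /choice[a aP]; have [J0 JD JM] := iJ.
pose B := \max_(i < n) a i.
have BP i : J (cmono 1 (U_(i) *+ B)%MM).
  have aB : (a i <= B)%N by exact: (leq_bigmax i).
  have -> : (U_(i) *+ B = U_(i) *+ (B - a i) + U_(i) *+ a i)%MM.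
    by apply/mnmP => j; rewrite mnmDE !mulmnE -mulnDr subnK.
  by rewrite -[1](mulr1 1) -cmonoM; exact: JM.
exists (n * B).+1 => g gN.
pose pk (u : 'X_{1..n}) := [pick i : 'I_n | (B <= u i)%N].
pose gi (i : 'I_n) : A := Fps (fun v : 'X_{1..n} =>
  if pk (v + U_(i) *+ B)%MM == Some i then fps_coef g (v + U_(i) *+ B)%MM else 0).
have -> : g = \sum_(i < n) gi i * cmono 1 (U_(i) *+ B)%MM.
  apply: fpsP => u; rewrite fps_coef_sum.
  have E (i : 'I_n) : fps_coef (gi i * cmono 1 (U_(i) *+ B)%MM) u =
      if pk u == Some i then fps_coef g u else 0.
    rewrite mulrC coef_cmonoM mul1r /=.
    have UB : (U_(i) *+ B <= u)%MM = (B <= u i)%N.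
      apply/mnm_lepP/idP => [/(_ i)|Bu j]; rewrite mulmnE mnm1E; first by rewrite eqxx mul1n.
      by case: eqP => [<-|_]; rewrite ?mul1n.
    rewrite UB; case: ifP => [Bu|Bu]; first by rewrite submK // UB.
    by rewrite /pk; case: pickP => [j Bj|//]; case: eqP => // -[ji]; rewrite -ji Bj in Bu.
  rewrite (eq_bigr _ (fun i _ => E i)) {E}; rewrite /pk; case: pickP => [i Bi|no].
    rewrite (bigD1 i) //= eqxx big1 ?addr0 // => j ji.
    by case: eqP => // -[ij]; rewrite ij eqxx in ji.
  rewrite big1 // gN // ltnS mdegE.
  apply: (@leq_trans (\sum_(i < n) B)%N); last by rewrite sum_nat_const card_ord.
  by apply: leq_sum => i _; have := no i; lia.
by elim/big_ind: _ => // i _; exact: JM.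
Qed.

End Lengths.

(** * Quotients by the product of the first [d] variables and powers of their ideals *)

Section MonomialQuotient.
Local Open Scope classical_set_scope.
Local Open Scope ring_scope.
Variables (n d : nat) (K : fieldType) (S : comPzRingType).
Local Notation A := (fps n K).

(** A common interface for both rings in question: a surjective morphism whose kernel is generated
    by the product of the first [d] variables. *)
Record nc_quot (phi : A -> S) : Prop := NcQuot {
  nc_D : {morph phi : g h / g + h};
  nc_M : {morph phi : g h / g * h};
  nc_1 : phi 1 = 1;
  nc_surj : forall s, exists g, phi g = s;
  nc_ker : forall g, phi g = 0 <-> ncker d g }.

Variable phi : A -> S.
Hypothesis phi_nc : nc_quot phi.
Hypothesis dn : (0 < d <= n)%N.
Implicit Types (f g h : A) (I J : set S).

Let phiD := nc_D phi_nc.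
Let phiM := nc_M phi_nc.
Let phi1 := nc_1 phi_nc.
Let phi_surj := nc_surj phi_nc.
Let phi_ker := nc_ker phi_nc.

Let phi0 : phi 0 = 0.
Proof. by apply/phi_ker; have [] := @ideal_ncker n K d. Qed.

Let phiB g h : phi (g - h) = phi g - phi h.
Proof.
have phiN : phi (- h) = - phi h.
  by apply/eqP; rewrite -addr_eq0 -phiD addrC subrr phi0.
by rewrite phiD phiN.
Qed.

Lemma phiX g m : phi (g ^+ m) = phi g ^+ m.
Proof. by elim: m => [|m IH]; rewrite ?expr0 // !exprS phiM IH. Qed.

Lemma ideal_preimage J : ideal J -> ideal (phi @^-1` J).
Proof.
move=> [J0 JD JM]; split=> [|g h gJ hJ|a g gJ] /=; rewrite ?phi0 ?phiD ?phiM //.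
- exact: JD.
- exact: JM.
Qed.

Lemma ncker_preimage J : ideal J -> ncker d `<=` phi @^-1` J.
Proof. by move=> [J0 _ _] g /phi_ker /= ->. Qed.

Lemma ideal_image (J : set A) : ideal J -> ideal (phi @` J).
Proof.
move=> [J0 JD JM]; split.
- by exists 0.
- by move=> _ _ [g Jg <-] [h Jh <-]; exists (g + h); rewrite ?phiD //; exact: JD.
- move=> a _ [g Jg <-]; have [b <-] := phi_surj a; exists (b * g); rewrite ?phiM //.
  exact: JM.
Qed.

Lemma preimage_image (J : set A) : ideal J -> ncker d `<=` J -> phi @^-1` (phi @` J) `<=` J.
Proof.
move=> [_ JD _] dJ g [h Jh gh]; rewrite -[g](subrK h); apply: JD => //.
by apply/dJ/phi_ker; rewrite phiB gh subrr.
Qed.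

Lemma krull_dim_nc : krull_dim S = n.-1.
Proof.
rewrite -(@krull_ncker n K d dn); apply: (max_chain_length_surj phi_surj).
- move=> J [iJ J1 JM]; split; last exact: ncker_preimage.
  split; [exact: ideal_preimage|by rewrite /= phi1|].
  by move=> x y /=; rewrite phiM => /JM.
- move=> I [[iI I1 IM] dI]; have IK := preimage_image iI dI.
  split; [exact: ideal_image|by move=> I1'; apply/I1/IK; rewrite /= phi1|].
  move=> s t; have [g <-] := phi_surj s; have [h <-] := phi_surj t.
  by rewrite -phiM => /IK/IM[]; [left; exists g|right; exists h].
- by move=> I [[iI _ _] dI]; exact: preimage_image.
Qed.

Lemma quo_length_nc J N : ideal J -> ord_ge N `<=` phi @^-1` J ->
  quo_length J = std_count (phi @^-1` J) N.
Proof.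
move=> iJ NJ; rewrite -(quo_length_std _ NJ); last exact: ideal_preimage.
apply: (max_chain_length_surj phi_surj).
- move=> I [iI JI]; split; first exact: ideal_preimage.
  by move=> g /=; exact: JI.
- move=> I [iI JI]; split; first exact: ideal_image.
  by move=> s Js; have [g gs] := phi_surj s; exists g => //; apply: JI; rewrite /= gs.
- move=> I [iI JI]; apply: preimage_image => //.
  exact: subset_trans (ncker_preimage iJ) JI.
Qed.

Lemma coef0_ncker g : ncker d g -> fps_coef g 0%MM = 0.
Proof.
case/andP: dn => d0 dn' gd; have n0 := leq_trans d0 dn'.
by apply: (gd _ (Ordinal n0)) => //; rewrite mnm0E.
Qed.

Lemma unit_nc g : (exists t, phi g * t = 1) <-> fps_coef g 0%MM != 0.
Proof.
split=> [[t gt]|/fps_unit[h gh]]; last first.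
  by exists (phi h); rewrite -phiM gh phi1.
have [h ht] := phi_surj t; apply/eqP => g0.
have : phi (g * h - 1) = 0 by rewrite phiB phiM ht gt phi1 subrr.
move=> /phi_ker/coef0_ncker/eqP; rewrite fps_coefD fps_coefN fps_coefM big1 => [|k].
  by rewrite fps_coef1 eqxx sub0r oppr_eq0 oner_eq0.
move=> /mnm_lepP k0; have -> : val k = 0%MM.
  by apply/mnmP => i; apply/eqP; rewrite mnm0E -leqn0; have := k0 i; rewrite mnm0E.
by rewrite g0 mul0r.
Qed.

Lemma nonunits_nc s : nonunits S s <-> exists2 g, ord_ge 1 g & phi g = s.
Proof.
split=> [su|[g g1 <-]]; last first.
  by move=> /unit_nc; rewrite g1 ?eqxx // mdeg0.
have [g gs] := phi_surj s; exists g => // u; rewrite ltnS leqn0 mdeg_eq0 => /eqP ->.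
apply/eqP/negPn/negP => /unit_nc[t gt]; apply: su; exists t.
by rewrite -gs.
Qed.

Lemma primary_pure_powers I : primary_to_max I ->
  forall i : 'I_n, exists a, (phi @^-1` I) (cmono 1 (U_(i) *+ a)%MM).
Proof.
move=> [iI rad] i.
have : nonunits S (phi (cmono 1 U_(i)%MM)).
  by apply/nonunits_nc; exists (cmono 1 U_(i)%MM) => //; apply: cmono_ord_ge; rewrite mdeg1.
rewrite -rad => -[a Ia]; exists a; move: Ia; rewrite -phiX /=.
suff -> : cmono 1 U_(i)%MM ^+ a = cmono 1 (U_(i) *+ a)%MM :> A by [].
elim: a => [|a IH]; first by rewrite expr0 mulm0n cmono_1.
by rewrite exprS IH cmonoM mulr1 mulmS.
Qed.

Lemma primary_exp_ord_ge I m : primary_to_max I ->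
  exists N, ord_ge N `<=` phi @^-1` (ideal_exp I m).
Proof.
move=> pI; apply: pure_powers_ord_ge; first exact/ideal_preimage/ideal_ideal_exp.
move=> i; have [a Ia] := primary_pure_powers pI i; exists (a * m)%N.
have -> : cmono 1 (U_(i) *+ (a * m))%MM = cmono 1 (U_(i) *+ a)%MM ^+ m :> A.
  elim: m => [|m IH]; first by rewrite muln0 mulm0n expr0 cmono_1.
  rewrite exprS -IH cmonoM mulr1 mulnS; congr cmono.
  by apply/mnmP => j; rewrite mnmDE !mulmnE mulnDr.
by rewrite /= phiX; exact: ideal_exp_pow.
Qed.

Lemma primary_proper I : primary_to_max I -> ~ I 1.
Proof.
move=> [iI rad] I1; have : radical I 1 by exists 1%N; rewrite expr1.
by rewrite rad; apply; exists 1; rewrite mul1r.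
Qed.

Lemma primary_inm0 I : primary_to_max I -> ~ inm (phi @^-1` I) 0%MM.
Proof.
move=> pI [g Ig [g0 _]]; apply: (primary_proper pI).
have /unit_nc[t <-] := g0; rewrite mulrC; case: pI => -[_ _ M] _; exact: M.
Qed.

(** The upward closure of the [m]-fold sumset of [M]; for [M] the exponents of a monomial ideal,
    those of its [m]-th power. *)
Definition msum (M : set 'X_{1..n}) m : set 'X_{1..n} :=
  [set u | exists2 p : 'I_m -> 'X_{1..n}, (forall j, M (p j)) &
     forall i, (\sum_(j < m) p j i <= u i)%N].

(** Initial monomials add under products. The excess of [u] over the sum is left to the zeroth
    power, which is the whole ring. *)
Lemma inm_exp I m : msum (inm (phi @^-1` I)) m `<=` inm (phi @^-1` (ideal_exp I m)).
Proof.
elim: m => [u _|m IH u [p pM pu]]; first by exists (cmono 1 u) => //; exact: initial_cmono.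
have p0u : (p ord0 <= u)%MM.
  by apply/mnm_lepP => i; apply: leq_trans (pu i); rewrite big_ord_recl leq_addr.
have /IH[h hI hu] : msum (inm (phi @^-1` I)) m (u - p ord0)%MM.
  exists (fun j => p (lift ord0 j)) => // i.
  by rewrite mnmBE leq_subRL; [have := pu i; rewrite big_ord_recl|move/mnm_lepP: p0u; apply].
have [g gI gu] := pM ord0; exists (g * h).
  by rewrite /= phiM; exact: ideal_mulP.
by rewrite -(submK p0u) addmC; exact: initialM.
Qed.

(** The [N]-th power of the maximal ideal of [S]. *)
Definition nc_ord N : set S := phi @` (ord_ge N).

Lemma primary_nc_ord N : (0 < N)%N -> primary_to_max (nc_ord N).
Proof.
move=> N0; split; first exact/ideal_image/ideal_ord_ge.
apply/seteqP; split=> s.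
  move=> [m [g gN gs]]; move=> [t st].
  have [h hs] := phi_surj s.
  have : exists t', phi g * t' = 1.
    by exists (t ^+ m); rewrite gs -exprMn st expr1n.
  by move=> /unit_nc; rewrite gN ?eqxx // mdeg0.
move=> /nonunits_nc[g g1 <-]; exists N; rewrite -phiX; exists (g ^+ N) => //.
elim: (N) => [|k IH]; first by rewrite expr0; exact: ord_ge0.
by rewrite exprS -add1n; exact: ord_geM.
Qed.

Lemma nc_ord_exp_sub N m : ideal_exp (nc_ord N) m `<=` nc_ord (N * m).
Proof.
elim: m => [s _|m IH].
  by have [g <-] := phi_surj s; exists g => //; rewrite muln0; exact: ord_ge0.
apply: ideal_mul_sub; first exact/ideal_image/ideal_ord_ge.
move=> _ _ [g gN <-] /IH[h hN <-]; exists (g * h); last exact: phiM.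
by rewrite mulnS; exact: ord_geM.
Qed.

Lemma mdeg_split (u : 'X_{1..n}) N : (N <= mdeg u)%N ->
  exists2 v : 'X_{1..n}, (v <= u)%MM & mdeg v = N.
Proof.
elim: N => [_|N IH Nu].
  by exists 0%MM; rewrite ?mdeg0 //; apply/mnm_lepP => i; rewrite mnm0E.
have [v vu vN] := IH (ltnW Nu).
have [i ui] : exists i, (v i < u i)%N.
  apply: contrapT => /forallNP no; move: Nu; rewrite -vN ltnNge => /negP; apply.
  by rewrite !mdegE; apply: leq_sum => i _; rewrite leqNgt; apply/negP.
exists (v + U_(i))%MM; last by rewrite mdegD mdeg1 vN addn1.
apply/mnm_lepP => j; rewrite mnmDE mnm1E.
case: eqP => [<-|_]; first by rewrite addn1.
by rewrite addn0; move/mnm_lepP: vu; apply.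
Qed.

Lemma msum_mdeg (M : set 'X_{1..n}) N m u :
  (forall v, (N <= mdeg v)%N -> M v) -> (N * m <= mdeg u)%N -> msum M m u.
Proof.
move=> NM; elim: m u => [u _|m IH u]; first by exists (fun=> 0%MM) => [[]|i]; rewrite ?big_ord0.
rewrite mulnS => Nu; have [v vu vN] := mdeg_split (leq_trans (leq_addr _ _) Nu).
have [|p pM pu] := IH (u - v)%MM.
  by have := congr1 mdeg (submK vu); rewrite mdegD; lia.
exists (fun j => if unlift ord0 j is Some j' then p j' else v) => [j|i].
  by case: unliftP => [j' _|_]; [exact: pM|apply: NM; rewrite vN].
rewrite big_ord_recl unlift_none; under eq_bigr => j _ do rewrite liftK.
by have := pu i; rewrite mnmBE leq_subRL //; move/mnm_lepP: vu; apply.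
Qed.

(** An element of the power lifts to a series of order at least [N * m], so in smaller degrees only
    the kernel supplies initial monomials. *)
Lemma inm_nc_ord_exp N m u : (0 < N)%N ->
  inm (phi @^-1` (ideal_exp (nc_ord N) m)) u <->
  (N * m <= mdeg u)%N \/ forall i : 'I_n, (i < d)%N -> u i != 0%N.
Proof.
move=> N0; split=> [[g /nc_ord_exp_sub[h hN hg] gu]|].
  have [|uN] := leqP (N * m) (mdeg u); first by left.
  right; apply/inm_ncker; exists (g - h); first by apply/phi_ker; rewrite phiB hg subrr.
  apply: (initialD gu uN); have [_ _ M] := @ideal_ord_ge n K (N * m).
  by rewrite -mulN1r; exact: M.
move=> [Nu|/(@inm_ncker n K d u)]; last exact: (inmS (ncker_preimage (ideal_ideal_exp _ _))).
apply: inm_exp; apply: msum_mdeg Nu => v Nv.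
exists (cmono 1 v); last exact: initial_cmono.
by exists (cmono 1 v) => //; exact: cmono_ord_ge.
Qed.

(** The Hilbert function of [S]: the exponents of degree below [k] on the union of the [d] faces are
    the standard monomials of the [k]-th power of its maximal ideal. *)
Definition face_count k :=
  #|[pred u : 'X_{1..n < k} | [exists i : 'I_n, (i < d)%N && (val u i == 0%N)]]|.

Lemma quo_length_nc_ord N m : (0 < N)%N ->
  quo_length (ideal_exp (nc_ord N) m) = face_count (N * m).
Proof.
move=> N0; have iE := ideal_ideal_exp (nc_ord N) m.
set V := phi @^-1` (ideal_exp (nc_ord N) m).
have iV : ideal V by exact: ideal_preimage.
have [L LV] := primary_exp_ord_ge m (primary_nc_ord N0).
have sO : ksubspace (@ord_ge n K (N * m)) by exact/ideal_ksubspace/ideal_ord_ge.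
have NV : ord_ge (N * m) `<=` V.
  (* Primariness only gives some large [L]. The order is brought down to [N * m] by comparing [V]
     with [V + ord_ge (N * m)], which has the same initial monomials. *)
  apply: subset_trans (inm_sub_eq (ideal_ksubspace iV)
    (ksubspace_addset (ideal_ksubspace iV) sO) (addsetl sO) LV _).
    exact/addsetr/ideal_ksubspace.
  move=> u uW; have [Nu|uN] := leqP (N * m) (mdeg u).
    by apply/inm_nc_ord_exp => //; left.
  exact: inm_addset_ord_ge uN uW.
rewrite (quo_length_nc iE NV); apply: eq_card => u.
apply/stdP/existsP => [uV|[i /andP[id /eqP ui]] /(inm_nc_ord_exp _ _ N0)[|/(_ i id)]].
- apply: contrapT => no; apply: uV; apply/inm_nc_ord_exp => //; right => i id.
  by apply/negP => ui; apply: no; exists i; rewrite id ui.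
- by rewrite leqNgt bmdeg.
- by rewrite ui.
Qed.

End MonomialQuotient.

(** * Counting exponents outside the m-fold sums *)

(** Passing from [y] to [y + 1] shifts the window of summation: the term [y %/ m] leaves and
    [(y + m) %/ m], larger by one, enters. *)
Lemma hermite_divn m y : 0 < m -> \sum_(j < m) (y + j) %/ m = y.
Proof.
move=> m0; elim: y => [|y IH].
  by apply: big1 => j _; rewrite add0n divn_small.
case: m m0 IH => // m m0 IH.
have E : \sum_(j < m.+2) (y + j) %/ m.+1 = (\sum_(j < m.+1) (y + j) %/ m.+1) + (y %/ m.+1).+1.
  by rewrite big_ord_recr /= divnDr // divnn addn1.
move: E; rewrite IH big_ord_recl /= addn0 => E.
rewrite [RHS](_ : _ = y + (y %/ m.+1).+1 - y %/ m.+1); last by lia.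
rewrite -E addKn; apply: eq_bigr => j _; congr (_ %/ _); rewrite /bump /=; lia.
Qed.

Lemma hermite_divn_rev m y : 0 < m -> \sum_(j < m) (y + (m.-1 - j)) %/ m = y.
Proof.
move=> m0; rewrite -[RHS](hermite_divn y m0) (reindex_inj rev_ord_inj) /=.
by apply: eq_bigr => j _; congr ((y + _) %/ m); have := ltn_ord j; lia.
Qed.

(** The values with quotient [p] lie in an interval of length [m], which for [p = 0] is cut off at 0
    and keeps at most [m - c] points. *)
Lemma card_divn_fiber L m c p : 0 < m ->
  #|[pred y : 'I_L | (y + c) %/ m == p]| <= (if p == 0 then m - c else m).
Proof.
move=> m0; pose b := (p * m - c)%N; pose e := if p == 0 then m - c else m.
have bnd (y : 'I_L) : (y + c) %/ m == p -> b <= y < b + e.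
  move=> /eqP yp; have := divn_eq (y + c) m; have := ltn_pmod (y + c) m0.
  rewrite yp /b /e; case: eqP => [->|] ; nia.
rewrite -/e -[X in _ <= X]card_ord.
case: (posnP e) => [e0|e0].
  by rewrite eq_card0 // => y; apply/negbTE/negP => /bnd; rewrite e0; lia.
pose f (y : 'I_L) : 'I_e := insubd (Ordinal e0) (y - b)%N.
apply: (@leq_card_in _ _ f) => y z /bnd yb /bnd zb /(congr1 val).
by rewrite /f !val_insubd !ifT; [move=> E; apply/val_inj => /=; lia|lia|lia].
Qed.

(** Cut the interval below the sum into consecutive blocks of lengths [a j]: [t] has position [s] in
    block [j]. *)
Lemma sum_split_index m (a : 'I_m -> nat) t : t < \sum_(j < m) a j ->
  exists j : 'I_m, exists2 s, s < a j & t = (\sum_(j' < m | j' < j) a j') + s.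
Proof.
elim: m a t => [a t|m IH a t]; first by rewrite big_ord0.
rewrite big_ord_recr /=; set X := \sum_(i < m) _ => tX.
have split (j : 'I_m) : \sum_(j' < m.+1 | j' < widen_ord (leqnSn m) j) a j' =
    \sum_(j' < m | j' < j) a (widen_ord (leqnSn m) j').
  rewrite big_mkcond big_ord_recr /= ifF; last by apply/negbTE; rewrite -leqNgt ltnW.
  by rewrite addn0 [RHS]big_mkcond.
have [Xt|/IH[j [s sj ->]]] := leqP X t; last by exists (widen_ord (leqnSn m) j), s; rewrite ?split.
exists ord_max, (t - X); first by lia.
rewrite big_mkcond big_ord_recr /= ltnn addn0.
rewrite (_ : \sum_(i < m) _ = X) ?subnKC //.
by apply: eq_bigr => j _; rewrite ltn_ord.
Qed.

(* Bounds the number of exponents on the face [u i = 0] that are attached to the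
   point [p] outside the initial ideal; asymptotically [m ^ d] times the volume
   that [p] contributes. *)
Definition face_weight d (m : nat) (i s : 'I_d) (p : 'X_{1..d.+1}) :=
  \sum_(j < m) \prod_(k < d | k != i)
    (if p (widen_ord (leqnSn d) k) == 0 then (if k == s then j.+1 else m - j) else m).

Section FaceBound.
Local Open Scope classical_set_scope.
Variables (d : nat) (M : set 'X_{1..d.+1}) (N : nat).
Hypothesis M_deg : forall u, N <= mdeg u -> M u.

Implicit Types (u q : 'X_{1..d.+1}).
Let T : 'I_d.+1 := ord_max.
Let w (k : 'I_d) : 'I_d.+1 := widen_ord (leqnSn d) k.

Variables (m : nat) (i s : 'I_d).
Hypothesis m0 : 0 < m.

(** With the offsets reversed in direction [s], the fibres over 0 there grow with [j] while those in
    the other directions shrink; this opposition lowers the sum of their products. *)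
Let off (k : 'I_d) (j : nat) := if k == s then m.-1 - j else j.

(* By Hermite's identity the [m] exponents [part u j] add up to [u], but for the
   last coordinate. *)
Let part (u : 'X_{1..d.+1}) (j : nat) : 'X_{1..d.+1} := [multinom
  if insub (k : nat) is Some k' then if k' == i then 0 else (u k + off k' j) %/ m else 0
  | k < d.+1].

Let partE u j k : part u j (w k) = if k == i then 0 else (u (w k) + off k j) %/ m.
Proof. by rewrite mnmE insubT //= => kd; rewrite (_ : Sub _ _ = k) //; apply/val_inj. Qed.

Let partT u j : part u j T = 0.
Proof. by rewrite mnmE insubF // ltnn. Qed.

Let ord_case (k : 'I_d.+1) : k = T \/ exists k', k = w k'.
Proof.
have [kd|dk] := ltnP k d; last first.
  by left; apply/val_inj => /=; have := ltn_ord k; lia.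
by right; exists (Ordinal kd); apply/val_inj.
Qed.

Let sum_part u k : u (w i) = 0 -> \sum_(j < m) part u j (w k) = u (w k).
Proof.
move=> ui; under eq_bigr => j _ do rewrite partE.
case: eqP => [->|_]; first by rewrite big1.
by rewrite /off; case: eqP => _; [exact: hermite_divn_rev|exact: hermite_divn].
Qed.

Let height_ex q : exists t, `[< M (q + U_(T) *+ t)%MM >].
Proof.
exists N; apply/asboolP/M_deg; rewrite mdegD mdegMn mdeg1 mul1n; exact: leq_addl.
Qed.

(** The height of the staircase of [M] above [q] in the direction of the last variable. *)
Let height q := ex_minn (height_ex q).

Let height_in q : M (q + U_(T) *+ height q)%MM.
Proof. by rewrite /height; case: ex_minnP => t /asboolP. Qed.

Let height_out q t : t < height q -> ~ M (q + U_(T) *+ t)%MM.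
Proof.
rewrite /height; case: ex_minnP => h _ hmin th Mt.
by have := hmin t (asboolT Mt); rewrite leqNgt th.
Qed.

(** If [u] is not an [m]-fold sum, its last coordinate is below the sum of the heights of its parts,
    so it falls at some position [t] in the block of some part [j]. Then [p = part u j + t T] is
    outside [M], and [u] is charged to [(p, j)]. *)
Lemma face_bound L :
  #|[pred u : 'X_{1..d.+1 < L} | (val u (w i) == 0) && ~~ `[< msum M m (val u) >]]| <=
  \sum_(p : 'X_{1..d.+1 < N} | ~~ `[< M (val p) >] && (val p (w i) == 0))
    face_weight m i s (val p).
Proof.
pose r (x : 'X_{1..d.+1 < N} * 'I_m) := ~~ `[< M (val x.1) >] && (val x.1 (w i) == 0).
pose B (x : 'X_{1..d.+1 < N} * 'I_m) : pred 'X_{1..d.+1 < L} :=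
  fun u : 'X_{1..d.+1 < L} => [&& val u (w i) == 0, [forall k : 'I_d, part (val u) x.2 (w k) == val x.1 (w k)] &
      val u T == (\sum_(j' < m | j' < x.2) height (part (val u) j')) + val x.1 T].
apply: (@leq_trans (\sum_(x | r x) #|B x|)).
  apply: card_union_bound => u /andP[/eqP ui /negP uM].
  have /sum_split_index[j [t tj uT]] : val u T < \sum_(j < m) height (part (val u) j).
    rewrite ltnNge; apply/negP => hu; apply: uM; apply: asboolT.
    exists (fun j => part (val u) j + U_(T) *+ height (part (val u) j))%MM => [j|k].
      exact: height_in.
    under eq_bigr => j _ do rewrite mnmDE mulmnE mnm1E.
    case: (ord_case k) => [->|[k' ->]].
      by rewrite eqxx; under eq_bigr => j _ do rewrite partT mul1n add0n.
    have -> : T == w k' = false.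
      by apply/negbTE/eqP => /(congr1 val) /= dk; have := ltn_ord k'; rewrite -dk ltnn.
    by under eq_bigr => j _ do rewrite mul0n addn0; rewrite sum_part.
  pose p := (part (val u) j + U_(T) *+ t)%MM.
  have pM : ~ M p by exact: height_out.
  have pN : mdeg p < N by rewrite ltnNge; apply/negP => /M_deg.
  have pw k : p (w k) = part (val u) j (w k).
    rewrite mnmDE mulmnE mnm1E (_ : T == w k = false) ?mul0n ?addn0 //.
    by apply/negbTE/eqP => /(congr1 val) /= dk; have := ltn_ord k; rewrite -dk ltnn.
  exists (BMultinom pN, j); rewrite /r /B /=.
    by rewrite pw partE eqxx eqxx andbT; apply/negP => /asboolP.
  apply/and3P; split; first by rewrite ui.
    by apply/forallP => k; rewrite pw.
  by rewrite uT /p mnmDE partT mulmnE mnm1E eqxx mul1n add0n.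
rewrite [X in _ <= X]pair_big_dep [X in _ <= X](eq_bigl r); last first.
  by move=> x; rewrite andbT.
apply: leq_sum => -[p j] /= /andP[_ pi].
have uL (u : 'X_{1..d.+1 < L}) k : val u k < L.
  apply: leq_ltn_trans (bmdeg u); rewrite mdegE (bigD1 k) //=; exact: leq_addr.
pose F (k : 'I_d) : pred 'I_L := fun y =>
  if k == i then val y == 0 else (y + off k j) %/ m == val p (w k).
pose f (u : 'X_{1..d.+1 < L}) : {ffun 'I_d -> 'I_L} := [ffun k => Ordinal (uL u (w k))].
(* Given [(p, j)], the first [d] coordinates determine [u]: they determine its parts, and the
   heights of these give the last coordinate. Each of these coordinates other than the [i]-th lies
   in a fibre of the rounding; the [i]-th is 0. *)
apply: (@leq_trans #|family F|).
  have f_inj : {in B (p, j) &, injective f}.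
    move=> u v /and3P[_ _ /eqP uT] /and3P[_ _ /eqP vT] /ffunP uv.
    have uvw k : val u (w k) = val v (w k) by have /(congr1 val) := uv k; rewrite !ffunE.
    have puv j' : part (val u) j' = part (val v) j'.
      apply/mnmP => k; case: (ord_case k) => [->|[k' ->]]; first by rewrite !partT.
      by rewrite !partE uvw.
    apply/val_inj/mnmP => k; case: (ord_case k) => [->|[k' ->]] //.
    by rewrite uT vT; congr (_ + _); apply: eq_bigr => j' _; rewrite puv.
  rewrite -(card_in_imset f_inj); apply/subset_leq_card/fintype.subsetP.
  move=> _ /imsetP[u /and3P[/eqP ui /forallP up _] ->]; apply/familyP => k.
  rewrite ffunE unfold_in /F /=; have := up k; rewrite partE.
  by have [->|//] := eqVneq k i; rewrite ui.
rewrite card_family foldrE big_map big_enum /= (bigD1 i) //=.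
rewrite -[X in _ <= X]mul1n leq_mul //.
  apply/card_le1_eqP => y z; rewrite !unfold_in /F eqxx => /eqP y0 /eqP z0.
  by apply/val_inj; rewrite y0 z0.
apply: leq_prod => k ki.
have -> : #|F k| = #|[pred y : 'I_L | (y + off k j) %/ m == val p (w k)]|.
  by apply: eq_card => y; rewrite !unfold_in /F (negPf ki).
apply: leq_trans (card_divn_fiber _ _ _ m0) _; case: eqP => // _; rewrite /off.
by case: eqP => // _; have := ltn_ord j; lia.
Qed.

End FaceBound.

(** * Limits of the face weights *)

Section Asymptotics.
Local Open Scope classical_set_scope.
Local Open Scope ring_scope.
Variable F : realType.

(** The [lim] of a divergent sequence is 0 by default, and that case is covered by [0 <= B]. *)
Lemma lim_le_of_bound (u b : nat -> F) (B : F) :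
  (forall m, (0 < m)%N -> u m <= b m) -> b @ \oo --> B -> 0 <= B -> lim (u @ \oo) <= B.
Proof.
move=> ub bB B0; have [cu|/dvgP ->] := pselect (cvg (u @ \oo)); last exact: B0.
apply: (ler_cvg_to cu bB); near=> m; apply: ub; near: m; exact: nbhs_infty_gt.
Unshelve. all: by end_near. Qed.

Lemma cvg_invn : (fun m : nat => m%:R^-1 : F) @ \oo --> (0 : F).
Proof. by rewrite -cvg_shiftS; exact: cvg_harmonic. Qed.

(** Discrete form of comparing a sum with an integral: telescope the bound [z.+1 * m.+1 ^ z] on the
    difference of consecutive powers. [powsum_le] is the opposite estimate. *)
Lemma powsum_ge z m : (m ^ z.+1 <= z.+1 * \sum_(t < m) t.+1 ^ z)%N.
Proof.
elim: m => [|m IH]; first by rewrite exp0n.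
rewrite big_ord_recr /= mulnDr.
suff : (m.+1 ^ z.+1 <= m ^ z.+1 + z.+1 * m.+1 ^ z)%N.
  by move=> H; apply: leq_trans H _; rewrite leq_add2r.
elim: z {IH} => [|z IH]; first by rewrite !expn1 expn0; lia.
rewrite expnS; apply: leq_trans (leq_mul (leqnn m.+1) IH) _.
rewrite mulnDr [(m.+1 * m ^ _)%N]mulSn -expnS.
have : (m ^ z.+1 <= m.+1 ^ z.+1)%N by rewrite leq_exp2r.
rewrite mulnCA -expnS; lia.
Qed.

Lemma powsum_le z m : (z.+1 * \sum_(t < m) t.+1 ^ z <= m.+1 ^ z.+1)%N.
Proof.
elim: m => [|m IH]; first by rewrite big_ord0 muln0.
rewrite big_ord_recr /= mulnDr.
suff : (m.+1 ^ z.+1 + z.+1 * m.+1 ^ z <= m.+2 ^ z.+1)%N.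
  by apply: leq_trans; rewrite leq_add2r.
elim: z {IH} => [|z IH]; first by rewrite !expn1 expn0; lia.
rewrite [X in (_ <= X)%N]expnS; apply: leq_trans (leq_mul (leqnn m.+2) IH).
rewrite mulnDr [(m.+2 * m.+1 ^ _)%N]mulSn -expnS.
rewrite [(m.+2 * (_ * _))%N]mulnCA [(m.+2 * _)%N]mulSn -expnS; nia.
Qed.

Lemma cvg_powsum z :
  (fun m : nat => (\sum_(t < m) t.+1 ^ z)%N%:R / m%:R ^+ z.+1 : F) @ \oo --> (z.+1%:R^-1 : F).
Proof.
have z0 : 0 < z.+1%:R :> F by rewrite ltr0n.
apply: (@squeeze_cvgr _ _ _ _ (fun=> z.+1%:R^-1) (fun m => z.+1%:R^-1 * (1 + m%:R^-1) ^+ z.+1)).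
- near=> m.
  have m0 : 0 < m%:R :> F by rewrite ltr0n; near: m; exact: nbhs_infty_gt.
  have mz0 : 0 < m%:R ^+ z.+1 :> F by rewrite exprn_gt0.
  apply/andP; split.
    rewrite ler_pdivlMr // mulrC ler_pdivrMr // mulrC -natrX -natrM ler_nat.
    exact: powsum_ge.
  rewrite ler_pdivrMr // -mulrA -exprMn mulrDl mul1r mulVf ?gt_eqF //.
  rewrite mulrC ler_pdivlMr // mulrC -natrM natr1 -natrX ler_nat.
  exact: powsum_le.
- exact: cvg_cst.
- rewrite -[X in _ --> X]mulr1; apply: cvgM; first exact: cvg_cst.
  have c1 : (fun m : nat => 1 + m%:R^-1 : F) @ \oo --> (1 : F).
    by rewrite -[X in _ --> X]addr0; apply: cvgD; [exact: cvg_cst|exact: cvg_invn].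
  elim: z.+1 => [|k IH].
    by rewrite (_ : (fun m => _) = fun=> 1); [exact: cvg_cst|apply/funext => m; rewrite expr0].
  rewrite (_ : (fun m => _) = fun m : nat => (1 + m%:R^-1) * (1 + m%:R^-1) ^+ k).
    by rewrite -[X in _ --> X](mulr1 1); apply: cvgM.
  by apply/funext => m; rewrite exprS.
Unshelve. all: by end_near. Qed.

Section FaceWeight.
Variables (d : nat) (i s : 'I_d) (p : 'X_{1..d.+1}).
Hypothesis si : s != i.
Let w (k : 'I_d) := widen_ord (leqnSn d) k.
Let z := #|[pred k : 'I_d | (k != i) && (p (w k) == 0%N)]|.

(** The integral over [0,1] of [x (1 - x)^(z-1)] if the coordinate [s] of [p] vanishes, and of
    [(1 - x)^z] otherwise. *)
Definition face_limit : F :=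
  if p (w s) == 0%N then z%:R^-1 - z.+1%:R^-1 else z.+1%:R^-1.

Let z_lt : (z < d)%N.
Proof.
rewrite -[X in (_ < X)%N]card_ord; apply: proper_card; apply/properP.
split; first exact/fintype.subsetP.
by exists i => //; rewrite inE eqxx.
Qed.

Let face_weightE m : face_weight m i s p =
  (m ^ (d - z.+1) * \sum_(j < m)
     (if p (w s) == 0 then j.+1 * (m - j) ^ z.-1 else (m - j) ^ z))%N.
Proof.
rewrite /face_weight mulnC big_distrl /=; apply: eq_bigr => j _.
rewrite (bigID (fun k => p (w k) == 0%N)) /=; congr (_ * _)%N.
  case: ifP => ps.
    rewrite (bigD1 s) /=; last by rewrite si.
    rewrite ps eqxx; congr (_ * _)%N.
    rewrite (eq_bigr (fun=> m - j)%N) => [|k /andP[/andP[_ ->] /negPf ->] //].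
    rewrite prod_nat_const; congr (_ ^ _)%N.
    rewrite [in RHS]/z [in RHS](cardD1 s) inE si ps add1n /=; apply: eq_card => k.
    by rewrite !inE andbC.
  rewrite (eq_bigr (fun=> m - j)%N); first by rewrite prod_nat_const.
  move=> k /andP[_ pk]; rewrite pk; case: eqP => // ks.
  by rewrite -ks pk in ps.
rewrite (eq_bigr (fun=> m)) => [|k /andP[_ /negPf ->] //].
rewrite prod_nat_const; congr (_ ^ _)%N.
have := cardC1 i; rewrite card_ord => c1.
have := cardID [pred k : 'I_d | p (w k) == 0%N] (predC1 i); rewrite c1.
have -> : #|[predI predC1 i & [pred k : 'I_d | p (w k) == 0%N]]| = z.
  by apply: eq_card.
pose y := #|[pred k : 'I_d | (k != i) && (p (w k) != 0%N)]|.
have -> : #|[predD predC1 i & [pred k : 'I_d | p (w k) == 0%N]]| = y.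
  by apply: eq_card => k; rewrite !inE andbC.
suff : (z + y = d.-1 -> y = d - z.+1)%N by apply.
by move: z_lt; lia.
Qed.

Let S e m := (\sum_(t < m) t.+1 ^ e)%N.

Let sum_rev e m : (\sum_(j < m) (m - j) ^ e = S e m)%N.
Proof.
rewrite (reindex_inj rev_ord_inj) /=; apply: eq_bigr => j _; congr (_ ^ _)%N.
by have := ltn_ord j; lia.
Qed.

(** Since [j.+1 + (m - j) = m.+1], the mixed sum reduces to pure power sums. *)
Let sum_mixed e m : (\sum_(j < m) j.+1 * (m - j) ^ e + S e.+1 m = m.+1 * S e m)%N.
Proof.
rewrite -!sum_rev -big_split big_distrr /=; apply: eq_bigr => j _.
by rewrite expnS -mulnDl; congr (_ * _)%N; have := ltn_ord j; lia.
Qed.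

Lemma cvg_face_weight :
  (fun m => (face_weight m i s p)%:R / m%:R ^+ d : F) @ \oo --> face_limit.
Proof.
have dE : d = ((d - z.+1) + z.+1)%N by rewrite subnK.
rewrite /face_limit; case: ifP => ps; last first.
  have -> : (fun m => (face_weight m i s p)%:R / m%:R ^+ d : F) =
            (fun m => (S z m)%:R / m%:R ^+ z.+1).
    apply/funext => m; rewrite face_weightE ps sum_rev.
    case: m => [|m]; first by rewrite /S big_ord0 muln0 !mul0r.
    by rewrite [X in m.+1%:R ^+ X]dE exprD natrM natrX invfM mulrACA divff ?mul1r.
  exact: cvg_powsum.
have z0 : (0 < z)%N.
  by apply/card_gt0P; exists s; rewrite inE si.
have -> : (fun m => (face_weight m i s p)%:R / m%:R ^+ d : F) =
    (fun m => (1 + m%:R^-1) * ((S z.-1 m)%:R / m%:R ^+ z.-1.+1) - (S z m)%:R / m%:R ^+ z.+1).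
  apply/funext => m; rewrite face_weightE ps.
  case: m => [|m]; first by rewrite /S !big_ord0 muln0 !mul0r mulr0 subrr.
  have m0 : m.+1%:R != 0 :> F by rewrite pnatr_eq0.
  have mixE : (\sum_(j < m.+1) j.+1 * (m.+1 - j) ^ z.-1)%N%:R =
      (m.+1%:R + 1) * (S z.-1 m.+1)%:R - (S z m.+1)%:R :> F.
    rewrite natr1 -natrM -sum_mixed (prednK z0) natrD addrK //.
  rewrite [X in m.+1%:R ^+ X]dE exprD natrM natrX invfM mulrACA divff ?expf_neq0 // mul1r.
  rewrite mixE mulrBl; congr (_ - _).
  rewrite (prednK z0) exprS invfM; set X := m.+1%:R; set Y := (S _ _)%:R.
  by rewrite mulrACA; congr (_ * _); rewrite mulrDl divff // mul1r.
apply: cvgB; last exact: cvg_powsum.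
rewrite -[X in _ --> X]mul1r; apply: cvgM.
  by rewrite -[X in _ --> X]addr0; apply: cvgD; [exact: cvg_cst|exact: cvg_invn].
rewrite -[in X in _ --> X](prednK z0); exact: cvg_powsum.
Qed.

Lemma face_limit_ge0 : 0 <= face_limit.
Proof.
rewrite /face_limit; case: ifP => ps; last by rewrite invr_ge0 ler0n.
have z0 : (0 < z)%N by apply/card_gt0P; exists s; rewrite inE si.
by rewrite subr_ge0 lef_pV2 ?posrE ?ltr0n // ler_nat.
Qed.

(** There are [z + 1] zeros once [i] is counted, and [1/z - 1/(z+1) <= 1/(z+1)] for [z >= 1]. *)
Lemma face_limit_le : p (w i) == 0%N ->
  face_limit <= #|[pred k : 'I_d | p (w k) == 0%N]|%:R^-1.
Proof.
move=> pi; rewrite (cardD1 i) inE pi add1n.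
have -> : #|[predD1 [pred k : 'I_d | p (w k) == 0%N] & i]| = z by apply: eq_card.
rewrite /face_limit; case: ifP => // ps.
have z0 : (0 < z)%N by apply/card_gt0P; exists s; rewrite inE si.
rewrite lerBlDr -mulr2n -[X in _ <= X]mulr_natr mulrC.
rewrite ler_pdivlMr ?ltr0n // mulrC ler_pdivrMr ?ltr0n // -natrM ler_nat; lia.
Qed.

End FaceWeight.

Lemma sum_face_limit_le d (s : 'I_d -> 'I_d) (p : 'X_{1..d.+1}) :
  (forall i, s i != i) ->
  \sum_(i < d | p (widen_ord (leqnSn d) i) == 0%N) face_limit i (s i) p <= 1.
Proof.
move=> si; set z := #|[pred k : 'I_d | p (widen_ord (leqnSn d) k) == 0%N]|.
apply: (@le_trans _ _ (\sum_(i < d | p (widen_ord (leqnSn d) i) == 0%N) z%:R^-1)).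
  by apply: ler_sum => i pi; exact: face_limit_le.
rewrite sumr_const -/z; case: (posnP z) => [->|z0]; first by rewrite mulr0n ler01.
by rewrite -[X in X <= _]mulr_natr mulVf // pnatr_eq0 -lt0n.
Qed.

(** At the origin the [d] faces contribute [1/(d-1) - 1/d] each, in total [1/(d-1)], which is below
    1 exactly from [d = 3] on. *)
Lemma sum_face_limit0_lt d (s : 'I_d -> 'I_d) (p : 'X_{1..d.+1}) : (3 <= d)%N ->
  (forall i, s i != i) -> p = 0%MM ->
  \sum_(i < d | p (widen_ord (leqnSn d) i) == 0%N) face_limit i (s i) p < 1.
Proof.
move=> d3 si ->; have d0 : d%:R != 0 :> F by rewrite pnatr_eq0; lia.
have d1 : d.-1%:R != 0 :> F by rewrite pnatr_eq0; lia.
rewrite (eq_bigl xpredT) => [|i]; last by rewrite mnm0E.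
rewrite (eq_bigr (fun=> d.-1%:R^-1 - d%:R^-1)) => [|i _].
  rewrite sumr_const card_ord -[X in X < _]mulr_natl mulrBr divff // ltrBlDr.
  rewrite ltr_pdivrMr ?ltr0n; last by lia.
  rewrite -mulr2n -natrM ltr_nat; lia.
rewrite /face_limit mnm0E eqxx.
have -> : #|[pred k : 'I_d | (k != i) && ((0%MM : 'X_{1..d.+1}) (widen_ord (leqnSn d) k) == 0%N)]| = d.-1.
  have := cardC1 i; rewrite card_ord => <-; apply: eq_card => k.
  by rewrite !inE mnm0E andbT.
by rewrite prednK //; lia.
Qed.

End Asymptotics.

(** * The upper bound for the Lech ratio *)

Section LechUpperBound.
Local Open Scope classical_set_scope.
Local Open Scope ring_scope.
Variables (F : realType) (d : nat) (K : fieldType) (S : comPzRingType).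
Variable phi : fps d.+1 K -> S.
Hypothesis phi_nc : nc_quot d phi.
Hypothesis d2 : (2 <= d)%N.
Variable I : set S.
Hypothesis pI : primary_to_max I.

Let dn : (0 < d <= d.+1)%N. Proof. by lia. Qed.
Let w (k : 'I_d) := widen_ord (leqnSn d) k.
(** The reversed direction has to differ from the face: direction 1 for face 0, direction 0 for
    every other face. Two directions exist because [2 <= d]. *)
Let s (i : 'I_d) : 'I_d := if val i == 0%N then Ordinal d2 else Ordinal (ltnW d2).

Let s_neq i : s i != i.
Proof.
by rewrite /s -val_eqE; case: (eqVneq (val i) 0%N) => [->|] //; rewrite eq_sym.
Qed.

Let iI : ideal I. Proof. by case: pI. Qed.

Lemma lech_ratio_nc_lt :
  lech_ratio F I <= 1 /\ ((3 <= d)%N -> lech_ratio F I < 1).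
Proof.
pose V := phi @^-1` I; have iV : ideal V := ideal_preimage phi_nc iI.
have [N NV] : exists N, ord_ge N `<=` V.
  by apply: pure_powers_ord_ge => // i; exact: (primary_pure_powers phi_nc dn pI).
pose C : pred 'X_{1..d.+1 < N} := fun u => ~~ `[< inm V (val u) >].
have CE : quo_length I = #|C|.
  rewrite (quo_length_nc phi_nc iI NV); apply: eq_card => u.
  exact: asbool_neg.
have M_deg (u : 'X_{1..d.+1}) : (N <= mdeg u)%N -> inm V u.
  move=> Nu; exists (cmono 1 u); last exact: initial_cmono.
  exact/NV/cmono_ord_ge.
(* A standard exponent of the [m]-th power lies on some face, where [face_bound] charges it to a
   standard exponent of [I]; so [W m] bounds the length. *)
pose W m := (\sum_(u | C u) \sum_(i < d | val u (w i) == 0%N) face_weight m i (s i) (val u))%N.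
have le_W m : (0 < m)%N -> (quo_length (ideal_exp I m) <= W m)%N.
  move=> m0; have [L LI] := primary_exp_ord_ge phi_nc dn m pI.
  rewrite (quo_length_nc phi_nc (ideal_ideal_exp _ _) LI).
  pose B (i : 'I_d) := [pred u : 'X_{1..d.+1 < L} |
    (val u (w i) == 0%N) && ~~ `[< msum (inm V) m (val u) >]].
  apply: (@leq_trans (\sum_(i < d) #|B i|)%N).
    apply: card_union_bound => u /stdP uI.
    have [i ui] : exists i : 'I_d, val u (w i) == 0%N.
      apply: contrapT => /forallNP no; apply: uI.
      apply: inmS (ncker_preimage phi_nc (ideal_ideal_exp I m)) _ _.
      apply/inm_ncker => i id; apply/negP => ui; apply: (no (Ordinal id)).
      by rewrite (_ : w _ = i) //; apply/val_inj.
    exists i => //; rewrite /B /= ui; apply/negP => /asboolP H; exact/uI/(inm_exp phi_nc).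
  rewrite /W (exchange_big_dep xpredT) //=; apply: leq_sum => i _.
  exact: (face_bound M_deg i (s i) m0 L).
pose G (u : 'X_{1..d.+1 < N}) := \sum_(i < d | val u (w i) == 0%N) face_limit F i (s i) (val u) : F.
pose B : F := \sum_(u | C u) G u.
have cvgW : (fun m => (W m)%:R / m%:R ^+ d : F) @ \oo --> B.
  rewrite (_ : (fun m => _) = fun m => \sum_(u | C u)
     \sum_(i < d | val u (w i) == 0%N) (face_weight m i (s i) (val u))%:R / m%:R ^+ d).
    apply: cvg_big => [|u _]; first exact: add_continuous.
    by apply: cvg_big => [|i _]; [exact: add_continuous|exact: cvg_face_weight].
  apply/funext => m; rewrite natr_sum mulr_suml; apply: eq_bigr => u _.
  by rewrite natr_sum mulr_suml.
have G0 (u : 'X_{1..d.+1 < N}) : 0 <= G u by apply: sumr_ge0 => i _; exact: face_limit_ge0.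
have G1 (u : 'X_{1..d.+1 < N}) : G u <= 1 by exact: sum_face_limit_le.
have d0 : 0 < d`!%:R :> F by rewrite ltr0n fact_gt0.
have multB : multiplicity F I <= d`!%:R * B.
  rewrite /multiplicity (krull_dim_nc phi_nc dn) /=.
  apply: (@lim_le_of_bound _ _ (fun m => d`!%:R * ((W m)%:R / m%:R ^+ d))).
  - move=> m m0; rewrite -mulrA ler_pM2l // ler_pM2r ?ler_nat ?le_W //.
    by rewrite invr_gt0 exprn_gt0 // ltr0n.
  - by apply: cvgM => //; exact: cvg_cst.
  - by apply: mulr_ge0; [exact: ltW|exact: sumr_ge0].
(* The exponent 0 is standard because [I] is proper. It makes the colength positive and, for
   [3 <= d], supplies the strict inequality. *)
have mdeg00 : (mdeg (0%MM : 'X_{1..d.+1}) < N)%N.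
  rewrite ltnNge; apply/negP => /M_deg; exact: (primary_inm0 phi_nc dn pI).
have C0 : C (BMultinom mdeg00).
  by apply/negP => /asboolP; exact: (primary_inm0 phi_nc dn pI).
have cardC : #|C|%:R = \sum_(u | C u) 1 :> F by rewrite sumr_const.
have C_gt0 : 0 < #|C|%:R :> F.
  by rewrite ltr0n; apply/card_gt0P; exists (BMultinom mdeg00).
have ratioE : lech_ratio F I <= B / #|C|%:R.
  rewrite /lech_ratio (krull_dim_nc phi_nc dn) /= CE ler_pdivrMr ?mulr_gt0 //.
  by rewrite mulrCA divfK ?gt_eqF.
split=> [|d3].
  apply: le_trans ratioE _; rewrite ler_pdivrMr // mul1r cardC.
  by apply: ler_sum => u _; exact: G1.
apply: le_lt_trans ratioE _; rewrite ltr_pdivrMr // mul1r cardC /B.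
rewrite (bigD1 (BMultinom mdeg00)) //= [X in _ < X](bigD1 (BMultinom mdeg00)) //=.
apply: ltr_leD; first exact: sum_face_limit0_lt.
by apply: ler_sum => u _; exact: G1.
Qed.

End LechUpperBound.

(** * Powers of the maximal ideal *)

Lemma card_bmultinom n k : #|{: 'X_{1..n < k.+1}}| = 'C(n + k, n).
Proof.
rewrite -card_partial_ord_partitions.
have uk (u : 'X_{1..n < k.+1}) i : val u i < k.+1.
  apply: leq_ltn_trans (bmdeg u); rewrite mdegE (bigD1 i) //=; exact: leq_addr.
pose f (u : 'X_{1..n < k.+1}) : n.-tuple 'I_k.+1 := [tuple Ordinal (uk u i) | i < n].
have f_inj : injective f.
  move=> u v uv; apply/val_inj/mnmP => i.
  by have := congr1 (fun t => val (tnth t i)) uv; rewrite !tnth_mktuple.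
rewrite -(card_imset predT f_inj); apply: eq_card => t; rewrite finset.in_set.
rewrite big_tuple; apply/imsetP/idP => [[u _ ->]|tk].
  under eq_bigr => i _ do rewrite tnth_mktuple /=.
  by rewrite -mdegE -ltnS bmdeg.
have b : mdeg [multinom val (tnth t i) | i < n] < k.+1.
  by rewrite ltnS mdegE; under eq_bigr => i _ do rewrite mnmE.
by exists (BMultinom b) => //; apply/eq_from_tnth => i; apply/val_inj; rewrite tnth_mktuple /= mnmE.
Qed.

(** The exponents off all faces are those divisible by the product [f] of the first [d] variables,
    and division by [f] lowers the degree by [d]. *)
Lemma face_count_card n d k : d <= n ->
  face_count n d k + #|{: 'X_{1..n < k - d}}| = #|{: 'X_{1..n < k}}|.
Proof.
move=> dn; pose f := [multinom (i < d : nat) | i < n].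
have fd : mdeg f = d.
  rewrite mdegE (eq_bigr (fun i : 'I_n => if i < d then 1 else 0)) => [|i _].
    by rewrite -big_mkcond -(big_ord_widen n (fun=> 1)) // sum1_card card_ord.
  by rewrite mnmE; case: ifP.
have b (v : 'X_{1..n < k - d}) : mdeg (val v + f)%MM < k.
  by rewrite mdegD fd; have : mdeg (val v) < k - d := bmdeg v; lia.
pose g (v : 'X_{1..n < k - d}) : 'X_{1..n < k} := BMultinom (b v).
have g_inj : injective g by move=> u v /(congr1 val) /= /addIm /val_inj.
rewrite -(card_imset predT g_inj) -(cardC [pred u : 'X_{1..n < k} |
  [exists i : 'I_n, (i < d) && (val u i == 0)]]); congr (_ + _).
apply: eq_card => u; rewrite [RHS]inE /= negb_exists.
apply/imsetP/forallP => [[v _ ->] i|ui].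
  by rewrite negb_and /= mnmDE mnmE addn_eq0; case: (i < d); rewrite ?andbF.
have fu : (f <= val u)%MM.
  apply/mnm_lepP => i; rewrite mnmE; case: (ltnP i d) => // id.
  by have := ui i; rewrite id /= lt0n.
have bu : mdeg (val u - f)%MM < k - d.
  have uk : mdeg (val u) < k := bmdeg u.
  by have := congr1 mdeg (submK fu); rewrite mdegD fd; lia.
by exists (BMultinom bu) => //; apply/val_inj; rewrite /= submK.
Qed.

(** The difference of the two binomial counts, telescoped by Pascal's rule. *)
Lemma face_count_bin n d k : d <= n.+1 ->
  face_count n.+1 d (d + k.+1) = \sum_(j < d) 'C(n.+1 + k + j, n).
Proof.
move=> dn; apply: (@addIn 'C(n.+1 + k, n.+1)).
have := face_count_card (d + k.+1) dn.
rewrite addKn addnS !card_bmultinom => ->.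
elim: d {dn} => [|d IH]; first by rewrite add0n big_ord0.
rewrite big_ord_recr /= addnAC -IH.
have -> : n.+1 + (d.+1 + k) = (n.+1 + (d + k)).+1 by lia.
by rewrite binS; congr (_ + 'C(_, _)); lia.
Qed.

Section FaceCountAsymptotics.
Local Open Scope classical_set_scope.
Local Open Scope ring_scope.
Variable F : realType.

Lemma prod_expansion p (t : nat -> F) : exists2 C, 0 <= C & forall x, 0 <= x <= 1 ->
  `|\prod_(i < p) (1 + t i * x) - 1 - (\sum_(i < p) t i) * x| <= C * x ^+ 2.
Proof.
elim: p => [|p [C C0 IH]].
  by exists 0 => // x _; rewrite !big_ord0 subrr mul0r subr0 normr0 mul0r.
set S := \sum_(i < p) t i in IH.
exists ((1 + `|t p|) * C + `|t p * S|) => [|x x01].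
  by rewrite addr_ge0 // mulr_ge0 // addr_ge0.
have /andP[x0 x1] := x01; have := IH x x01.
rewrite !big_ord_recr /= -/S; set P := \prod_(i < p) _ => PC.
rewrite [X in `|X|](_ : _ = (1 + t p * x) * (P - 1 - S * x) + t p * S * x ^+ 2); last by ring.
apply: le_trans (ler_normD _ _) _; rewrite [X in _ <= X]mulrDl; apply: lerD; last first.
  by rewrite normrM [`|x ^+ 2|]ger0_norm ?exprn_ge0.
rewrite normrM -mulrA; apply: ler_pM => //.
apply: le_trans (ler_normD _ _) _; rewrite normr1 lerD2l normrM (ger0_norm x0).
by rewrite -[X in _ <= X]mulr1; apply: ler_pM.
Qed.

Variables (n d : nat).
Hypothesis dn : (d <= n.+1)%N.

Definition face_ratio k : F := n`!%:R * (face_count n.+1 d k)%:R / k%:R ^+ n.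

(** The coefficient of [1/k] in [face_ratio k], that is, [n!] times the second coefficient of the
    Hilbert polynomial. *)
Definition face_slope : F := \sum_(j < d) \sum_(i < n) (n%:R + j%:R - i%:R - d%:R).

Lemma face_ratioE k : (d < k)%N -> face_ratio k =
  \sum_(j < d) \prod_(i < n) (1 + (n%:R + j%:R - i%:R - d%:R) * k%:R^-1).
Proof.
move=> dk; have [k' ->] : exists k', k = (d + k'.+1)%N by exists (k - d.+1)%N; lia.
rewrite /face_ratio face_count_bin // natr_sum mulr_sumr mulr_suml.
apply: eq_bigr => j _; rewrite -natrM mulnC bin_ffact ffact_prod natr_prod.
rewrite -exprVn -[X in _ ^+ X](card_ord n) -prodr_const -big_split /=.
apply: eq_bigr => i _; rewrite natrB; last by have := ltn_ord i; lia.
rewrite -[X in _ = X + _](@mulfV _ (d + k'.+1)%:R); last by rewrite pnatr_eq0; lia.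
rewrite -mulrDl; congr (_ * _); rewrite !natrD -!natr1; ring.
Qed.

Lemma face_ratio_expansion : exists2 C, 0 <= C & forall k, (d < k)%N ->
  `|face_ratio k - d%:R - face_slope / k%:R| <= C / k%:R ^+ 2.
Proof.
have /choice[C CP] : forall j : 'I_d, exists C : F, 0 <= C /\ forall x, 0 <= x <= 1 ->
    `|\prod_(i < n) (1 + (n%:R + j%:R - i%:R - d%:R) * x) - 1 -
      (\sum_(i < n) (n%:R + j%:R - i%:R - d%:R)) * x| <= C * x ^+ 2.
  move=> j; have [C C0 CP] := prod_expansion n (fun i => n%:R + j%:R - i%:R - d%:R).
  by exists C.
exists (\sum_j C j) => [|k dk]; first by apply: sumr_ge0 => j _; have [] := CP j.
have k01 : 0 <= (k%:R^-1 : F) <= 1.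
  by rewrite invr_ge0 ler0n /= invf_le1 ?ler1n ?ltr0n; lia.
rewrite -exprVn [X in _ <= X]mulr_suml.
have -> : face_ratio k - d%:R = \sum_(j < d)
    (\prod_(i < n) (1 + (n%:R + j%:R - i%:R - d%:R) * k%:R^-1) - 1).
  by rewrite face_ratioE // sumrB sumr_const card_ord.
rewrite /face_slope [X in _ - X]mulr_suml -sumrB.
by apply: le_trans (ler_norm_sum _ _ _) _; apply: ler_sum => j _; have [_] := CP j; apply.
Qed.

Lemma face_ratio_bound : exists2 E, 0 <= E & forall k, (d < k)%N ->
  `|face_ratio k - d%:R| <= E / k%:R.
Proof.
have [C C0 CP] := face_ratio_expansion.
exists (C + `|face_slope|) => [|k dk]; first exact: addr_ge0.
have k0 : 0 < k%:R :> F by rewrite ltr0n; lia.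
have -> : face_ratio k - d%:R = (face_ratio k - d%:R - face_slope / k%:R) + face_slope / k%:R.
  by rewrite subrK.
apply: le_trans (ler_normD _ _) _; rewrite mulrDl; apply: lerD; last first.
  by rewrite normrM (ger0_norm (x := k%:R^-1)) // invr_ge0 ltW.
apply: le_trans (CP k dk) _; rewrite ler_wpM2l // lef_pV2 ?posrE ?exprn_gt0 //.
by rewrite expr2; apply: ler_peMl; [exact: ltW|rewrite ler1n; lia].
Qed.

Lemma cvg_face_ratio N : (0 < N)%N ->
  (fun m => face_ratio (N * m)) @ \oo --> (d%:R : F).
Proof.
move=> N0; have [E E0 EP] := face_ratio_bound.
have cE : (fun m : nat => E * m%:R^-1) @ \oo --> (0 : F).
  by rewrite -[X in _ --> X](mulr0 E); apply: cvgM; [exact: cvg_cst|exact: cvg_invn].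
apply: (@squeeze_cvgr _ _ _ _ (fun m => d%:R - E * m%:R^-1) (fun m => d%:R + E * m%:R^-1)).
- near=> m.
  have dm : (d < m)%N by near: m; exact: nbhs_infty_gt.
  have dNm : (d < N * m)%N by apply: leq_trans dm _; exact: leq_pmull.
  have := EP _ dNm; have : E / (N * m)%:R <= E / m%:R.
    rewrite ler_wpM2l // lef_pV2 ?posrE ?ltr0n ?ler_nat ?leq_pmull //; lia.
  move=> /[swap] /le_trans /[apply]; rewrite ler_norml => /andP[lo hi].
  by apply/andP; split; lra.
- by rewrite -[X in _ --> X]subr0; apply: cvgB; [exact: cvg_cst|exact: cE].
- by rewrite -[X in _ --> X]addr0; apply: cvgD; [exact: cvg_cst|exact: cE].
Unshelve. all: by end_near. Qed.

Lemma face_ratio_lt : face_slope < 0 -> exists2 k, (0 < k)%N & face_ratio k < d%:R.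
Proof.
move=> s0; have [C C0 CP] := face_ratio_expansion.
(* Beyond [C / - face_slope] the negative first-order term outweighs the quadratic remainder. *)
pose k := (Num.bound (C / - face_slope) + d).+1; exists k => //.
have dk : (d < k)%N by rewrite ltnS leq_addl.
have k0 : 0 < k%:R :> F by rewrite ltr0n.
have := CP k dk; rewrite ler_norml => /andP[_]; rewrite lerBlDr => H.
have : C / k%:R ^+ 2 + face_slope / k%:R < 0.
  rewrite expr2 invfM mulrA -mulrDl pmulr_llt0 ?invr_gt0 //.
  rewrite -ltrBrDr sub0r ltr_pdivrMr // mulrC -ltr_pdivrMr ?oppr_gt0 //.
  apply: lt_le_trans (archi_boundP _) _.
    by rewrite divr_ge0 // oppr_ge0 ltW.
  by rewrite ler_nat leqW // leq_addr.
lra.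
Qed.

End FaceCountAsymptotics.

(** Gauss sums evaluate the slope to [- d (d+1) / 2]. *)
Lemma face_slope_lt0 (F : realType) d : (0 < d)%N -> (face_slope F d d.+1 < 0)%R.
Proof.
move=> d0; rewrite /face_slope.
have gauss p : (2 * (\sum_(i < p) i%:R) = p%:R * (p%:R - 1) :> F)%R.
  elim: p => [|p IH]; first by rewrite big_ord0 mulr0 mul0r.
  by rewrite big_ord_recr /= mulrDr IH -!natr1; ring.
have inner (j : 'I_d.+1) : (\sum_(i < d) (d%:R + j%:R - i%:R - d.+1%:R) =
    d%:R * (j%:R - 1) - \sum_(i < d) i%:R :> F)%R.
  rewrite [LHS](_ : _ = \sum_(i < d) ((j%:R - 1) - i%:R))%R.
    by rewrite sumrB sumr_const card_ord mulr_natl.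
  by apply: eq_bigr => i _; rewrite -natr1; ring.
rewrite (eq_bigr _ (fun j _ => inner j)) sumrB sumr_const card_ord -mulr_sumr sumrB.
rewrite sumr_const card_ord -mulr_natl -natr1.
have := gauss d; have := gauss d.+1; rewrite -natr1.
have : (0 < d%:R :> F)%R by rewrite ltr0n.
set X := (\sum_(i < d.+1) _)%R; set Y := (\sum_(i < d) _)%R; move=> d0' XE YE.
have -> : X = ((d%:R + 1) * d%:R / 2)%R by lra.
have -> : Y = (d%:R * (d%:R - 1) / 2)%R by lra.
nra.
Qed.

(** * The two rings as quotients of power series rings *)

Section PowerSeriesOverQuotient.
Local Open Scope ring_scope.
Variables (n d : nat) (K : fieldType) (R : comPzRingType) (phi : fps n K -> R).
Hypothesis phi_nc : nc_quot d phi.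
Hypothesis dn : (d <= n)%N.
Implicit Types (v : 'X_{1..n}) (u : 'X_{1..n.+1}).

Let T : 'I_n.+1 := ord_max.
Let w (k : 'I_n) : 'I_n.+1 := widen_ord (leqnSn n) k.

Let ext v (t : nat) : 'X_{1..n.+1} :=
  [multinom if insub (k : nat) is Some k' then v k' else t | k < n.+1].
Let res u : 'X_{1..n} := [multinom u (w k) | k < n].

Let ext_w v t k : ext v t (w k) = v k.
Proof. by rewrite mnmE insubT //= => kd; congr (v _); apply/val_inj. Qed.

Let ext_T v t : ext v t T = t.
Proof. by rewrite mnmE insubF // ltnn. Qed.

Let ord_case (k : 'I_n.+1) : k = T \/ exists k', k = w k'.
Proof.
have [kd|dk] := ltnP k n; last first.
  by left; apply/val_inj => /=; have := ltn_ord k; lia.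
by right; exists (Ordinal kd); apply/val_inj.
Qed.

Let ext_res u : ext (res u) (u T) = u.
Proof.
apply/mnmP => k; case: (ord_case k) => [->|[k' ->]]; first by rewrite ext_T.
by rewrite ext_w mnmE.
Qed.

Let res_ext v t : res (ext v t) = v.
Proof. by apply/mnmP => k; rewrite mnmE ext_w. Qed.

Let mdeg_ext v t : mdeg (ext v t) = (mdeg v + t)%N.
Proof.
rewrite !mdegE big_ord_recr /= -/T ext_T; congr (_ + _)%N.
by apply: eq_bigr => k _; rewrite -/(w k) ext_w.
Qed.

Let ext_le v v' t t' : (ext v t <= ext v' t')%MM = (v <= v')%MM && (t <= t')%N.
Proof.
apply/mnm_lepP/andP => [H|[/mnm_lepP H tt'] k].
  split; last by have := H T; rewrite !ext_T.
  by apply/mnm_lepP => k; have := H (w k); rewrite !ext_w.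
by case: (ord_case k) => [->|[k' ->]]; rewrite ?ext_T ?ext_w.
Qed.

Let ext_sub v v' t t' : (ext v t - ext v' t')%MM = ext (v - v')%MM (t - t').
Proof.
apply/mnmP => k; rewrite mnmBE.
by case: (ord_case k) => [->|[k' ->]]; rewrite ?ext_T ?ext_w ?mnmBE.
Qed.

(** The coefficient of [T^t], where [T] is the last variable; [sliceM] is then the Cauchy product in
    [T]. *)
Let slice t (g : fps n.+1 K) : fps n K := Fps (fun v => fps_coef g (ext v t)).

Let sliceM t g h : slice t (g * h) = \sum_(i < t.+1) slice i g * slice (t - i) h.
Proof.
apply: fpsP => v; rewrite fps_coef_sum.
change (fps_coef (g * h) (ext v t) =
  \sum_(i < t.+1) fps_coef (slice i g * slice (t - i) h) v).
rewrite fps_coefM (partition_big (fun u : 'X_{1..n.+1 < _} => inord (val u T) : 'I_t.+1) xpredT) //=.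
apply: eq_bigr => i _; set b := (mdeg (ext v t)).+1.
have vb : (mdeg v < b)%N by rewrite ltnS mdeg_ext leq_addr.
rewrite [RHS](_ : _ = fps_coef (fps_mul (slice i g) (slice (t - i) h)) v) //.
rewrite (fps_coef_mul _ _ vb) /=.
have b0 : (mdeg (0%MM : 'X_{1..n.+1}) < b)%N by rewrite mdeg0.
have bres (u : 'X_{1..n.+1 < b}) : (mdeg (res (val u)) < b)%N.
  apply: leq_ltn_trans (bmdeg u); rewrite -[X in (_ <= mdeg X)%N]ext_res mdeg_ext.
  exact: leq_addr.
(* [f] appends the exponent [i] of [T] and [f'] forgets it. The default of [insubd] does not occur
   for [a <= v], where the degree stays below [b]. *)
pose f (a : 'X_{1..n < b}) : 'X_{1..n.+1 < b} := insubd (BMultinom b0) (ext (val a) i).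
pose f' (u : 'X_{1..n.+1 < b}) : 'X_{1..n < b} := BMultinom (bres u).
have fE (a : 'X_{1..n < b}) : (val a <= v)%MM -> val (f a) = ext (val a) i.
  move=> av; rewrite val_insubd ifT // ltnS mdeg_ext mdeg_ext leq_add ?lem_mdeg //.
  by rewrite -ltnS.
rewrite (reindex_onto f f') => [|u /andP[ut /eqP ui]] /=; last first.
  have ut' : (val u T <= t)%N by move/mnm_lepP: ut => /(_ T); rewrite ext_T.
  have uT : val u T = i by rewrite -ui inordK.
  apply/val_inj; rewrite fE /= -?uT ?ext_res //.
  by move: ut; rewrite -{1}(ext_res (val u)) ext_le => /andP[].
have P (a : 'X_{1..n < b}) : ((val (f a) <= ext v t)%MM && (inord (val (f a) T) == i)) && (f' (f a) == a) =
    (val a <= v)%MM.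
  have [av|av] := boolP (val a <= v)%MM.
    rewrite fE // ext_le av -ltnS ltn_ord ext_T inord_val eqxx /=.
    by apply/eqP/val_inj; rewrite /= fE // res_ext.
  apply/negbTE; apply: contra av => /andP[/andP[fv _] /eqP fa].
  have -> : val a = res (val (f a)) by rewrite -[in LHS]fa.
  by move: fv; rewrite -{1}(ext_res (val (f a))) ext_le => /andP[].
apply: eq_big => [a|a Pa]; first exact: P.
have av : (val a <= v)%MM by rewrite -P.
by rewrite -[bmnm (f a)]/(val (f a)) fE // ext_sub.
Qed.

Let phi0 : phi 0 = 0.
Proof. by apply/(nc_ker phi_nc); have [] := @ideal_ncker n K d. Qed.

Let phi_sum m (G : 'I_m -> fps n K) : phi (\sum_(i < m) G i) = \sum_(i < m) phi (G i).
Proof. by apply: big_morph => //; exact: (nc_D phi_nc). Qed.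

Definition nc_lift (g : fps n.+1 K) : fps 1 R :=
  Fps (fun k : 'X_{1..1} => phi (slice (k ord0) g)).

Let mdeg_fps1 (k : 'X_{1..1}) : mdeg k = k ord0.
Proof. by rewrite mdegE big_ord1. Qed.

Let coef_fps1M (x y : fps 1 R) (k : 'X_{1..1}) : fps_coef (x * y) k =
  \sum_(i < (k ord0).+1) fps_coef x [multinom (i : nat) | _ < 1] *
                         fps_coef y [multinom (k ord0 - i)%N | _ < 1].
Proof.
have -> : fps_coef (x * y) k = \sum_(j : 'X_{1..1 < (mdeg k).+1} | (j <= k)%MM)
  fps_coef x j * fps_coef y (k - j)%MM by [].
have b (i : 'I_(k ord0).+1) : (mdeg [multinom (i : nat) | _ < 1] < (mdeg k).+1)%N.
  by rewrite !mdeg_fps1 mnmE.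
pose f (i : 'I_(k ord0).+1) : 'X_{1..1 < (mdeg k).+1} := BMultinom (b i).
pose f' (j : 'X_{1..1 < (mdeg k).+1}) : 'I_(k ord0).+1 := inord (val j ord0).
rewrite (reindex_onto f f') => [|j /mnm_lepP jk] /=; last first.
  apply/val_inj/mnmP => i; rewrite [i]ord1 /= mnmE /f' inordK // ltnS; exact: jk.
apply: eq_big => [i|i _].
  rewrite /f' /= mnmE inord_val eqxx andbT; apply/mnm_lepP => j.
  by rewrite [j]ord1 mnmE -ltnS.
by congr (_ * fps_coef y _); apply/mnmP => j; rewrite [j]ord1 mnmBE !mnmE.
Qed.

(** The product of the first [d] variables does not involve [T], so membership in the kernel is
    tested slice by slice; a preimage is chosen for each coefficient in [T]. *)
Lemma nc_quot_lift : nc_quot d nc_lift.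
Proof.
have [phiD phiM phi1 phi_surj phi_ker] := phi_nc.
have ker_slice g : ncker d g <-> forall t, ncker d (slice t g).
  split=> [gd t v i id vi|gd u i id ui].
    by apply: (gd _ (w i) id); rewrite ext_w.
  have iw : i = w (Ordinal (leq_trans id dn)) by apply/val_inj.
  rewrite -(ext_res u); apply: (gd (u T) (res u) (Ordinal (leq_trans id dn)) id).
  by rewrite mnmE -iw.
split.
- by move=> g h; apply: fpsP => k /=; rewrite -phiD; congr phi; apply: fpsP.
- move=> g h; apply: fpsP => k; rewrite coef_fps1M /= sliceM phi_sum.
  by apply: eq_bigr => i _; rewrite phiM !mnmE.
- apply: fpsP => k /=; have -> : (k == 0%MM) = (k ord0 == 0%N).
    by rewrite -mdeg_eq0 mdeg_fps1.
  case: eqP => [->|k0].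
    rewrite -[RHS]phi1; congr phi; apply: fpsP => v /=.
    congr (nat_of_bool _)%:R; rewrite -!mdeg_eq0 mdeg_ext addn0 //.
  rewrite -[RHS]phi0; congr phi; apply: fpsP => v /=.
  by rewrite -mdeg_eq0 mdeg_ext addn_eq0 [X in _ && X](introF eqP k0) andbF.
- move=> x; have /choice[h hP] : forall t, exists g, phi g = fps_coef x [multinom t | _ < 1].
    by move=> t; exact: phi_surj.
  exists (Fps (fun u : 'X_{1..n.+1} => fps_coef (h (u T)) (res u))); apply: fpsP => k /=.
  rewrite (_ : slice _ _ = h (k ord0)).
    by rewrite hP; congr fps_coef; apply/mnmP => j; rewrite [j]ord1 mnmE.
  by apply: fpsP => v /=; rewrite ext_T res_ext.
- move=> g; rewrite ker_slice; split=> [g0 t|gd].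
    apply/phi_ker; have := congr1 (fun x => fps_coef x [multinom t | _ < 1]) g0.
    by rewrite /= mnmE.
  by apply: fpsP => k /=; apply/phi_ker.
Qed.

End PowerSeriesOverQuotient.

Section NormalCrossing.
Local Open Scope ring_scope.
Local Open Scope quotient_scope.
Variables (d : nat) (K : fieldType).

Lemma prod_fps_var : \prod_(i < d) fps_var K i = cmono 1 [multinom 1%N | _ < d].
Proof.
have -> : [multinom 1%N | _ < d] = (\sum_(i < d) U_(i))%MM.
  apply/mnmP => j; rewrite mnmE mnm_sumE (bigD1 j) //= mnm1E eqxx big1 // => i ij.
  by rewrite mnm1E (negPf ij).
have E i : fps_var K i = cmono 1 U_(i)%MM :> fps d K.
  by apply: fpsP => u /=; case: eqP.
rewrite (eq_bigr _ (fun i _ => E i)) (big_morph (cmono 1) (id1 := 1) (op1 := *%R)) //.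
  by move=> u v; rewrite cmonoM mulr1.
exact: cmono_1.
Qed.

Definition nc_proj (g : fps d K) : normal_crossing K d :=
  \pi_{ideal_quot (principal (\prod_(i < d) fps_var K i))} g.

(** A series with no term on a face is divisible by the product of the variables: the quotient
    shifts all exponents down by 1. *)
Lemma nc_quot_proj : nc_quot d nc_proj.
Proof.
split.
- by move=> g h; rewrite /nc_proj raddfD.
- by move=> g h; rewrite /nc_proj -quo_mulE.
- by [].
- by move=> s; exists (repr s); rewrite /nc_proj reprK.
move=> g; have -> : nc_proj g = 0 <-> g \in principal (\prod_(i < d) fps_var K i).
  rewrite /nc_proj -[in X in X <-> _](raddf0 (\pi_{ideal_quot (principal (\prod_(i < d) fps_var K i))})).
  by rewrite -[g in X in _ <-> X]subr0 -quo_principalE; split => /eqP.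
rewrite prod_fps_var; split=> [/asboolP[h ->] u i _ ui|gd].
  rewrite mulrC coef_cmonoM ifF //; apply/negbTE/negP => /mnm_lepP/(_ i).
  by rewrite mnmE ui.
apply/asboolP; exists (Fps (fun u : 'X_{1..d} => fps_coef g (u + [multinom 1%N | _ < d])%MM)).
apply: fpsP => u; rewrite mulrC coef_cmonoM mul1r /=; case: ifP => [fu|fu].
  by rewrite submK.
have [i ui] : exists i, u i = 0%N.
  apply: contrapT => /forallNP no; move/negbT/negP: fu; apply; apply/mnm_lepP => i.
  by rewrite mnmE lt0n; apply/eqP/no.
exact: (gd u i).
Qed.

End NormalCrossing.

(** * The Lech-Mumford constant and powers of the maximal ideal *)

Section LechMumfordNormalCrossing.
Local Open Scope classical_set_scope.
Local Open Scope ring_scope.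
Variables (F : realType) (n d : nat) (K : fieldType) (S : comPzRingType).
Variable phi : fps n.+1 K -> S.
Hypothesis phi_nc : nc_quot d phi.
Hypothesis dn : (0 < d <= n.+1)%N.

Let d_le : (d <= n.+1)%N. Proof. by case/andP: dn. Qed.
Let d_neq0 : d%:R != 0 :> F. Proof. by rewrite pnatr_eq0; case/andP: dn; lia. Qed.

Lemma multiplicity_nc_ord N : (0 < N)%N ->
  multiplicity F (nc_ord phi N) = d%:R * N%:R ^+ n.
Proof.
move=> N0; rewrite /multiplicity (krull_dim_nc phi_nc dn) /=; apply: cvg_lim => //.
rewrite (_ : (fun m => _) = fun m => face_ratio F n d (N * m) * N%:R ^+ n).
  by apply: cvgM; [exact: cvg_face_ratio|exact: cvg_cst].
apply/funext => m; rewrite (quo_length_nc_ord phi_nc dn) // /face_ratio.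
rewrite natrM exprMn invfM -!mulrA; congr (_ * (_ * _)).
by rewrite mulrCA mulVf ?mulr1 // expf_neq0 // pnatr_eq0 -lt0n.
Qed.

Lemma lech_ratio_nc_ord N : (0 < N)%N ->
  lech_ratio F (nc_ord phi N) = d%:R / face_ratio F n d N.
Proof.
move=> N0; rewrite /lech_ratio multiplicity_nc_ord // (krull_dim_nc phi_nc dn) /=.
have -> : quo_length (nc_ord phi N) = face_count n.+1 d N.
  rewrite -[in RHS](muln1 N) -(quo_length_nc_ord phi_nc dn) //; congr quo_length.
  have iN : ideal (nc_ord phi N) by case: (primary_nc_ord phi_nc dn N0).
  apply/seteqP; split=> [x Nx|]; last exact: ideal_exp_sub.
  by rewrite -[x]mulr1; exact: ideal_mulP.
by rewrite /face_ratio invf_div mulrA.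
Qed.

Lemma face_count_gt0 k : (0 < k)%N -> (0 < face_count n.+1 d k)%N.
Proof.
move=> k0; apply/card_gt0P.
have b : (mdeg (0%MM : 'X_{1..n.+1}) < k)%N by rewrite mdeg0.
by exists (BMultinom b); apply/existsP; exists ord0; rewrite mnm0E eqxx; case/andP: dn => ->.
Qed.

Lemma face_ratio_gt0 k : (0 < k)%N -> 0 < face_ratio F n d k.
Proof.
move=> k0; rewrite divr_gt0 ?mulr_gt0 ?exprn_gt0 ?ltr0n ?fact_gt0 //.
exact: face_count_gt0.
Qed.

Lemma le_lech_mumford (I : set S) : primary_to_max I ->
  ((lech_ratio F I)%:E <= lech_mumford F S)%E.
Proof. by move=> pI; apply: ereal_sup_ubound; exists I. Qed.

(* The powers of the maximal ideal show that the constant is at least 1. *)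
Lemma lech_mumford_eq1 : (forall I : set S, primary_to_max I -> lech_ratio F I <= 1) ->
  lech_mumford F S = 1%:E.
Proof.
move=> le1; have sup_le : (lech_mumford F S <= 1%:E)%E.
  by apply: ge_ereal_sup => _ [I pI <-]; rewrite lee_fin le1.
apply/eqP; rewrite eq_le sup_le /=.
have sup_ge N : (0 < N)%N -> ((d%:R / face_ratio F n d N)%:E <= lech_mumford F S)%E.
  move=> N0; rewrite -lech_ratio_nc_ord //; apply: le_lech_mumford.
  exact: (primary_nc_ord phi_nc dn).
(* The instance [N = 1] excludes the value minus infinity, and the upper bound excludes plus
   infinity; the supremum is a real number. *)
have := sup_ge 1%N isT; move: sup_le sup_ge.
case: (lech_mumford F S) => [r| |] // _ sup_ge _; rewrite lee_fin.
have : (fun N => d%:R / face_ratio F n d (1 * N)) @ \oo --> (d%:R / d%:R : F).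
  by apply: cvgM; [exact: cvg_cst|apply: cvgV => //; exact: cvg_face_ratio].
rewrite divff // => /cvgr_to_le; apply; near=> N.
rewrite mul1n -lee_fin; apply: sup_ge; near: N; exact: nbhs_infty_gt.
Unshelve. all: by end_near. Qed.

End LechMumfordNormalCrossing.

(** The ring is [K[[x]]/(x)], of Krull dimension 0: all lengths are at most 1, and the length modulo
    the proper ideal [I] is positive. *)
Lemma lech_ratio_dim0 (F : realType) (K : fieldType) (S : comPzRingType)
    (phi : fps 1 K -> S) (I : set S) :
  nc_quot 1 phi -> primary_to_max I -> (lech_ratio F I <= 1)%R.
Proof.
move=> phi_nc pI; have dn : 0 < 1 <= 1 by [].
have iI : ideal I by case: pI.
have ql_le m : quo_length (ideal_exp I m) <= 1.
  have [L LI] := primary_exp_ord_ge phi_nc dn m pI.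
  rewrite (quo_length_nc phi_nc (ideal_ideal_exp _ _) LI).
  apply: leq_trans (std_count_ncker _ (ncker_preimage phi_nc (ideal_ideal_exp I m))) _.
  by rewrite mul1n expn0.
have ql_gt0 : 0 < quo_length I.
  have iV := ideal_preimage phi_nc iI.
  have [N NI] : exists N, (ord_ge N `<=` phi @^-1` I)%classic.
    by apply: pure_powers_ord_ge => // i; exact: (primary_pure_powers phi_nc dn pI).
  have NI' : (ord_ge N.+1 `<=` phi @^-1` I)%classic.
    by apply: subset_trans NI; exact: ord_ge_le.
  rewrite (quo_length_nc phi_nc iI NI'); apply: std_count_gt0 => //.
  by rewrite /= (nc_1 phi_nc); exact: primary_proper.
rewrite /lech_ratio (krull_dim_nc phi_nc dn) /= mul1r ler_pdivrMr ?ltr0n // mul1r.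
apply: (@le_trans _ _ 1%R); last by rewrite ler1n.
rewrite /multiplicity (krull_dim_nc phi_nc dn) /=.
apply: (@lim_le_of_bound _ _ (fun=> 1%R)) => [m _| |]; last exact: ler01.
  by rewrite expr0 divr1 mul1r lern1.
exact: cvg_cst.
Qed.

Theorem theorem6p2p1 (F : realType) (K : fieldType) (d : nat) (hd : 1 <= d) :
  (d = 1 -> lech_stable F (normal_crossing K d)) /\
  (d = 2 -> semistable F (normal_crossing K d) /\
            ~ stable F (normal_crossing K d)) /\
  (3 <= d -> stable F (normal_crossing K d) /\
             ~ lech_stable F (normal_crossing K d)).
Proof.
have projR := nc_quot_proj d K; have liftS := nc_quot_lift projR (leqnn d).
have dS : 0 < d <= d.+1 by rewrite hd /=.
have semi : 2 <= d -> semistable F (normal_crossing K d).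
  move=> d2; apply: (lech_mumford_eq1 liftS dS) => I pI.
  by have [] := lech_ratio_nc_lt F liftS d2 pI.
split=> [d1|]; last split=> [d2|d3].
- subst d; apply: (lech_mumford_eq1 projR) => // I pI.
  exact: (@lech_ratio_dim0 F K _ _ I projR pI).
- have d_ge2 : 2 <= d by rewrite d2.
  split; first exact: semi.
  (* The maximal ideal has multiplicity [d] and colength 1, so its ratio is [d / d!], which is 1 for
     [d = 2]: the supremum is attained. *)
  move=> [ss]; apply; exists (nc_ord (nc_lift (@nc_proj d K)) 1).
  split; first exact: (primary_nc_ord liftS dS).
  rewrite ss (lech_ratio_nc_ord F liftS dS) //; congr (_%:E)%E.
  have fc1 : face_count d.+1 d 1 = 1.
    have := face_count_card 1 (leqnSn d); rewrite card_bmultinom addn0 binn.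
    rewrite [X in _ + X]eq_card0 ?addn0 // => u.
    by have ub : mdeg (val u) < 1 - d := bmdeg u; exfalso; lia.
  by rewrite /face_ratio fc1 expr1n divr1 mulr1 d2 divff // pnatr_eq0.
split; first split; first exact/semi/ltnW.
  move=> [I [pI]]; rewrite (semi (ltnW d3)) => -[E].
  have [_ /(_ d3)] := lech_ratio_nc_lt F liftS (ltnW d3) pI.
  by rewrite E ltxx.
case: d hd d3 projR {liftS dS semi} => // n _ n2 projR sR.
have dR : 0 < n.+1 <= n.+1 by rewrite leqnn.
(* A negative slope makes [face_ratio] drop below its limit [d] at some [N], so the [N]-th power of
   the maximal ideal has a ratio above 1. *)
have [|N N0 ratio_lt] := face_ratio_lt (leqnn n.+1) (face_slope_lt0 F _); first by lia.
have := le_lech_mumford F (primary_nc_ord projR dR N0).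
rewrite sR (lech_ratio_nc_ord F projR dR) // lee_fin leNgt.
have r0 := face_ratio_gt0 F dR N0.
by rewrite ltr_pdivlMr // mul1r ratio_lt.
Qed.
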